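(* Let $\Bbbk$ be a field and let $\Delta$ be a simplicial complex of dimension $d-1$ that is Cohen--Macaulay over $\Bbbk$ and satisfies $\Delta=\operatorname{core}(\Delta)$. Assume that $\Delta$ satisfies one of the following: (1) $\Bbbk[\Delta]$ has a $1$-linear resolution; or (2) $a(\Delta)=0$, where $a(\Delta)$ denotes the $a$-invariant of $\Bbbk[\Delta]$. Then $$d\leq \operatorname{reg}(\Delta)+\operatorname{type}(\Delta)-1.$$
   Context: A simplicial complex $\Delta$ on a finite vertex set $V=\{v_1,\dots,v_n\}$ is a family of subsets of $V$ (faces) that contains $\{v\}$ for every $v\in V$, contains $\emptyset$, and is closed under taking subsets; $\dim(F)=|F|-1$ and $\dim(\Delta)=\max\{\dim(F):F\in\Delta\}$. Star and core: for $F\in\Delta$, $\operatorname{star}(F)=\{G\in\Delta: F\cup G\in\Delta\}$. $\operatorname{core}(V)=\{v\in V:\operatorname{star}(\{v\})\neq\Delta\}$ and $\operatorname{core}(\Delta)=\{F\in\Delta: F\subset \operatorname{core}(V)\}$. Thus $\Delta=\operatorname{core}(\Delta)$ means $\operatorname{core}(V)=V$. Stanley--Reisner ring: let $S=\Bbbk[x_1,\dots,x_n]$ with the standard grading, let $I_\Delta\subset S$ be the ideal generated by all squarefree monomials $x_{i_1}\cdots x_{i_\ell}$ with $\{v_{i_1},\dots,v_{i_\ell}\}\notin\Delta$, and let $\Bbbk[\Delta]=S/I_\Delta$. Its Krull dimension is $\dim(\Delta)+1$. $\Delta$ is Cohen--Macaulay over $\Bbbk$ if $\Bbbk[\Delta]$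 is a Cohen--Macaulay ring. Invariants: $\operatorname{reg}(\Delta)$ is the Castelnuovo--Mumford regularity of $\Bbbk[\Delta]$ as a graded $S$-module, i.e. $\operatorname{reg}(\Delta)=\max\{j : \operatorname{Tor}_i^S(\Bbbk,\Bbbk[\Delta])_{i+j}\neq 0 \text{ for some } i\}$. For $\Delta$ Cohen--Macaulay of dimension $d-1$ with $n$ vertices, $\operatorname{type}(\Delta)$ is the Cohen--Macaulay type of $\Bbbk[\Delta]$, i.e. $\operatorname{type}(\Delta)=\dim_\Bbbk \operatorname{Tor}_{n-d}^S(\Bbbk,\Bbbk[\Delta])$. The $a$-invariant is $a(\Delta)=-\min\{j:(\omega_\Delta)_j\neq0\}$, where $\omega_\Delta=\operatorname{Ext}^{n-d}_S(\Bbbk[\Delta],S(-n))$ is the graded canonical module of $\Bbbk[\Delta]$; one has $\operatorname{reg}(\Delta)=a(\Delta)+d$. The ring $\Bbbk[\Delta]$ has a $p$-linear resolution ($p\ge 1$) if $I_\Delta\neq 0$ and $\operatorname{Tor}_i^S(\Bbbk,\Bbbk[\Delta])_{i+j}=0$ for all $i\geq1$ and all $j\neq p$; in particular $\operatorname{reg}(\Delta)=p$ in that case. *)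

(* Defs.v *)
From HB Require Import structures.
From mathcomp Require Import all_boot all_order all_algebra.
From mathcomp Require Import generic_quotient ring_quotient.
From mathcomp.multinomials Require Import mpoly.
From mathcomp Require Import boolp.

Set Implicit Arguments.
Unset Strict Implicit.
Unset Printing Implicit Defensive.

Import GRing.Theory Num.Theory.
Local Open Scope ring_scope.

Record scomplex (n : nat) := SComplex {
  faces : {set {set 'I_n}};
  faces_vertex : forall v : 'I_n, [set v] \in faces;
  faces_empty : set0 \in faces;
  faces_sub : forall A B : {set 'I_n}, A \subset B -> B \in faces -> A \in faces
}.

Section Complexes.
Variables (n : nat) (D : scomplex n).

Definition sc_dim : int := (\max_(A in faces D) #|A|)%N%:Z - 1.

Definition star (A : {set 'I_n}) : {set {set 'I_n}} :=
  [set B in faces D | A :|: B \in faces D].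

Definition core_vertices : {set 'I_n} := [set v | star [set v] != faces D].

Definition core : {set {set 'I_n}} :=
  [set A in faces D | A \subset core_vertices].

End Complexes.

Section Ideals.
Variable R : comNzRingType.
Implicit Types (G J P m : R -> Prop) (a b x : R).

(* The ideal generated by the elements satisfying G. *)
Definition ideal_gen G a : Prop :=
  exists2 s : seq (R * R), (forall cg, cg \in s -> G cg.2)
                         & a = \sum_(cg <- s) cg.1 * cg.2.

Definition is_ideal J : Prop :=
  [/\ J 0, forall a b, J a -> J b -> J (a + b) & forall a b, J b -> J (a * b)].

Definition is_prime P : Prop :=
  [/\ is_ideal P, ~ P 1 & forall a b, P (a * b) -> P a \/ P b].

Definition is_maximal m : Prop :=
  [/\ is_ideal m, ~ m 1
    & forall J, is_ideal J -> (forall a, m a -> J a) ->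
        J 1 \/ forall a, J a -> m a].

Definition noetherian : Prop :=
  forall J, is_ideal J ->
    exists s : seq R, forall a, J a <-> ideal_gen (fun x => x \in s) a.

(* h <= dim R_m : the primes of R_m are the primes of R contained in m. *)
Definition local_dim_ge m (h : nat) : Prop :=
  exists Q : nat -> R -> Prop,
    [/\ forall i, (i <= h)%N -> is_prime (Q i),
        forall i, (i < h)%N ->
          (forall a, Q i a -> Q i.+1 a) /\ exists2 a, Q i.+1 a & ~ Q i a
      & forall a, Q h a -> m a].

(* a / 1 belongs to the extension of J to the localization R_m. *)
Definition in_localization m J a : Prop := exists2 s, ~ m s & J (s * a).

(* h <= depth R_m : R_m has a regular sequence of length h inside its maximal
   ideal.  The elements may be taken in m itself, multiplying them by units
   of R_m.  The nontriviality condition R_m <> (xs) R_m follows from xs lying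
   in m. *)
Definition local_depth_ge m (h : nat) : Prop :=
  exists xs : seq R,
    [/\ size xs = h, forall x, x \in xs -> m x
      & forall i, (i < h)%N -> forall a,
          let J := ideal_gen (fun x => x \in take i xs) in
          in_localization m J (nth 0 xs i * a) -> in_localization m J a].

(* R is Noetherian and depth R_m = dim R_m for every maximal ideal m. *)
Definition cohen_macaulay : Prop :=
  noetherian /\
  forall m, is_maximal m ->
    forall h, local_depth_ge m h <-> local_dim_ge m h.

End Ideals.

Section StanleyReisner.
Variables (K : fieldType) (n : nat) (D : scomplex n).
Local Notation S := {mpoly K[n]}.

Definition is_nonface_monomial (p : S) : Prop :=
  exists2 A : {set 'I_n}, A \notin faces D & p = \prod_(i in A) 'X_i.

Definition SR_ideal : S -> Prop := ideal_gen is_nonface_monomial.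

Definition SR_pred (p : S) : bool := `[< SR_ideal p >].

Lemma SR_ideal_coeff0 p : SR_ideal p -> p@_0%MM = 0.
Proof.
case=> s sP ->; elim: s sP => [|[c g] s IHs] sP; first by rewrite big_nil mcoeff0.
rewrite big_cons mcoeffD IHs => [|cg cg_s]; last first.
  by apply: sP; rewrite inE cg_s orbT.
have /= [A AD ->] := sP (c, g) (mem_head _ _).
have [A0|[i iA]] := set_0Vmem A; first by rewrite A0 faces_empty in AD.
by rewrite (bigD1 i) //= !rmorphM /= mcoeffX mnm1_eq0 mul0r mulr0 addr0.
Qed.

Lemma SR_idealr_closed : idealr_closed SR_pred.
Proof.
split=> [||p q r /asboolP [s sP ->] /asboolP [t tP ->]].
- by apply/asboolP; exists [::] => //; rewrite big_nil.
- apply/negP => /asboolP /SR_ideal_coeff0 /eqP.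
  by rewrite mcoeff1 eqxx oner_eq0.
apply/asboolP; exists ([seq (p * cg.1, cg.2) | cg <- s] ++ t) => [cg|].
  by rewrite mem_cat => /orP [/mapP [cg' /sP ? ->]|/tP].
rewrite big_cat big_map mulr_sumr /=; congr (_ + _).
by apply: eq_bigr => cg _; rewrite mulrA.
Qed.

HB.instance Definition _ := isIdealr.Build S SR_pred SR_idealr_closed.

Definition SR_idealr : idealr S := SR_pred.

Definition SR_ring : comNzRingType := {ideal_quot SR_idealr}.

End StanleyReisner.

Arguments SR_ideal K {n} D p.
Arguments SR_ring K {n} D.

Section Resolutions.
Variables (K : fieldType) (n : nat).
Local Notation S := {mpoly K[n]}.

(* Homogeneous of degree e; only 0 is homogeneous of negative degree. *)
Definition zhomog (e : int) (p : S) : Prop :=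
  if e is Posz m then p \is m.-homog else p = 0.

(* Graded free resolutions  ... -> F_1 -> F_0 -> S/I -> 0  with every F_i of
   finite rank.  F_i is the module of row vectors of size rk i, its u-th basis
   vector has degree deg i u, and matrices act on the right.  The augmentation
   F_0 -> S/I sends w to the class of w *m aug. *)
Record gfree_resolution (I : S -> Prop) := GFreeResolution {
  rk : nat -> nat;
  deg : forall i, 'I_(rk i) -> int;
  diff : forall i, 'M[S]_(rk i.+1, rk i);
  aug : 'cV[S]_(rk 0);
  diff_homog : forall i u v, zhomog (deg u - deg v) (diff i u v);
  aug_homog : forall u, zhomog (deg u) (aug u 0);
  aug_surj : exists w : 'rV[S]_(rk 0), I ((w *m aug) 0 0 - 1);
  exact0 : forall w : 'rV[S]_(rk 0),
    I ((w *m aug) 0 0) <-> exists z, w = z *m diff 0;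
  exactS : forall i (w : 'rV[S]_(rk i.+1)),
    w *m diff i = 0 <-> exists z, w = z *m diff i.+1
}.

Variables (I : S -> Prop) (F : gfree_resolution I).

(* Tor^S(K, S/I) is the homology of K (x)_S F, where K = S/(x_1, ..., x_n):
   the matrices of the differentials are reduced to their constant terms. *)
Definition diffK i : 'M[K]_(rk F i.+1, rk F i) :=
  map_mx (mcoeff 0%MM) (diff F i).

Definition tor_cycles i : 'M[K]_(rk F i) :=
  match i with
  | 0%N => 1%:M
  | i'.+1 => kermx (diffK i')
  end.

Definition tor_dim i : nat := (\rank (tor_cycles i) - \rank (diffK i))%N.

(* The degree e part of K (x) F_i. *)
Definition tor_strand i (e : int) : 'M[K]_(rk F i) :=
  diag_mx (\row_u (deg u == e)%:R).

(* dim_K Tor_i(K, S/I)_e *)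
Definition tor_gdim i (e : int) : nat :=
  (\rank (tor_cycles i :&: tor_strand i e)%MS
     - \rank (diffK i :&: tor_strand i e)%MS)%N.

Definition is_regularity (r : int) : Prop :=
  (exists i : nat, tor_gdim i (i%:Z + r) <> 0%N) /\
  forall (i : nat) (j : int), tor_gdim i (i%:Z + j) <> 0%N -> j <= r.

Definition has_linear_resolution (p : nat) : Prop :=
  (exists2 f, I f & f <> 0) /\
  forall (i : nat) (j : int), (1 <= i)%N -> j <> p%:Z ->
    tor_gdim i (i%:Z + j) = 0%N.

(* Degree j homomorphisms F_i -> S(-n), given by the images of the basis
   vectors: the u-th one lies in S(-n)_(deg u + j) = S_(deg u + j - n). *)
Definition is_cochain i (j : int) (v : 'cV[S]_(rk F i)) : Prop :=
  forall u, zhomog (deg u + j - n%:Z) (v u 0).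

Definition is_coboundary i (j : int) : 'cV[S]_(rk F i) -> Prop :=
  match i with
  | 0%N => fun v => v = 0
  | i'.+1 => fun v => exists2 w, is_cochain j w & v = diff F i' *m w
  end.

(* Ext^i_S(S/I, S(-n))_j <> 0 *)
Definition ext_neq0 i (j : int) : Prop :=
  exists v : 'cV[S]_(rk F i),
    [/\ is_cochain j v, diff F i *m v = 0 & ~ is_coboundary j v].

(* a = - min {j | omega_j <> 0}, where omega = Ext^c_S(S/I, S(-n)) and c is
   the codimension. *)
Definition is_a_invariant (c : nat) (a : int) : Prop :=
  ext_neq0 c (- a) /\ forall j, ext_neq0 c j -> - a <= j.

End Resolutions.

(* Main.v *)
Require Import Defs.
From HB Require Import structures.
From mathcomp Require Import all_boot all_order all_algebra.
From mathcomp Require Import generic_quotient ring_quotient boolp zify.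
From mathcomp.multinomials Require Import mpoly.

Set Implicit Arguments.
Unset Strict Implicit.
Unset Printing Implicit Defensive.

Import Order.TTheory GRing.Theory Num.Theory.
Local Open Scope ring_scope.

(* In case (2) the cocycle representing a nonzero element of degree 0 of the
   canonical module is, up to coboundaries, nonzero on a minimal generator of
   degree at least n, so that Tor_(n-d) is nonzero in some degree e >= n; hence
   the type is positive and the regularity is at least e - (n - d) >= d.

   In case (1) the Betti number beta_(n-d) is computed by the Koszul complex of
   the Stanley-Reisner ring.  Its part of multidegree W with #|W| = n - d + 1 is
   the reduced cohomology H^0 of the restriction of D to W.  Linearity makes the
   1-skeleton chordal and D its clique complex; depth d makes the complement of
   any set of fewer than d - 1 vertices connected.  A chordal graph has a
   simplicial vertex w, and its neighbours form a separator of exactly d - 1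
   vertices; eliminating simplicial vertices until d vertices remain produces
   n - d independent classes.  One elimination creates at most one vertex
   adjacent to all others.  There is none at the start since D is its own core,
   and d of them at the end, whence d <= n - d. *)

(** * The Koszul complex *)

(** The resolution [F] is arbitrary, so its matrices may contain units and Tor cannot be read from
    its ranks. Tor is therefore probed by explicit Koszul cycles, and one half of the comparison
    suffices: a Koszul cycle whose Tor class vanishes is a Koszul boundary. This detects nonzero
    classes and, when Tor vanishes, makes cycles bound. Neither multigraded Tor nor simplicial
    cohomology is built. Each multidegree statement is read from coefficients at a single monomial
    supported on a face, where elements of the ideal have coefficient 0. Depth is known only after
    localisation, so vanishing holds up to a multiplier with nonzero constant term; this multiplier
    is invisible in the lowest coefficients. In case (1) a simplicial vertex belongs to the graph
    left so far, while depth and the classes concern separators of the whole graph; [extendable] is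
    the invariant that bridges the two. The classes lie in total degree n - d + 1 of Tor_(n-d),
    hence their number bounds the type from below, and their existence gives regularity at least
    1. *)

Section Koszul.
Variables (R : comNzRingType) (n : nat) (x : 'I_n -> R).

(** The exponent of the sign produced by moving e_j into its place in the increasing product e_A. *)
Definition pos (j : 'I_n) (A : {set 'I_n}) : nat := #|[set k in A | (k < j)%N]|.

Lemma posU1 j k (A : {set 'I_n}) : k \notin A -> pos j (k |: A) = ((k < j)%N + pos j A)%N.
Proof.
move=> kA; rewrite /pos; case: ltnP => kj.
  rewrite (_ : [set i in k |: A | _] = k |: [set i in A | (i < j)%N]).
    by rewrite cardsU1 inE (negPf kA).
  by apply/setP => i; rewrite !inE; case: eqP => // ->; rewrite kj.
rewrite add0n; apply: eq_card => i; rewrite !inE; case: eqP => // ->.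
by rewrite ltnNge kj (negPf kA).
Qed.

Lemma posD1 j k (A : {set 'I_n}) : k \in A -> pos j A = ((k < j)%N + pos j (A :\ k))%N.
Proof. by move=> kA; rewrite -[in LHS](setD1K kA) posU1 ?setD11. Qed.

Lemma pos_swap (j l : 'I_n) (A : {set 'I_n}) : j != l -> j \notin A -> l \notin A ->
  (-1) ^+ (pos j A + pos l (j |: A)) = - (-1) ^+ (pos l A + pos j (l |: A)) :> R.
Proof.
move=> jl jA lA; rewrite !posU1 //.
case: (ltngtP j l) jl => [_ _|_ _|/val_inj ->]; last by rewrite eqxx.
  by rewrite add0n addnCA exprS mulN1r addnC.
by rewrite add0n [in RHS]addnCA [in RHS]exprS mulN1r opprK addnC.
Qed.

Variable M : lmodType R.
Implicit Types (z u : {set 'I_n} -> M) (A : {set 'I_n}).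

(* A map z : {set 'I_n} -> M encodes \sum_A z A e_A in M (x) Lambda R^n, where
   e_A is the increasing wedge product; [kd] is the Koszul differential for the
   sequence x and [ke a] is left multiplication by \sum_j a_j e_j. *)
Definition kd z A : M :=
  \sum_(j | j \notin A) ((-1) ^+ pos j A * x j) *: z (j |: A).

Definition ke (a : 'I_n -> R) z A : M :=
  \sum_(j in A) ((-1) ^+ pos j A * a j) *: z (A :\ j).

Definition ksupp (i : nat) z := forall A, #|A| != i -> z A = 0.

(** Coefficients obtained by choice carry no control on the size of [A]; truncation restores a chain
    of pure Koszul degree, and by [kd_trunc] its boundary is unchanged where it matters. *)
Definition ktrunc (i : nat) z A : M := if #|A| == i then z A else 0.

Lemma ktrunc_supp i z : ksupp i (ktrunc i z).
Proof. by move=> A /negPf; rewrite /ktrunc => ->. Qed.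

Lemma kd_trunc i z A : #|A| = i -> kd (ktrunc i.+1 z) A = kd z A.
Proof.
by move=> Ai; apply: eq_bigr => j jA; rewrite /ktrunc cardsU1 jA Ai eqxx.
Qed.

Lemma kd_supp i z : ksupp i.+1 z -> ksupp i (kd z).
Proof.
move=> zi A Ai; apply: big1 => j jA.
by rewrite zi ?scaler0 // cardsU1 jA.
Qed.

Lemma ke_supp i a z : ksupp i z -> ksupp i.+1 (ke a z).
Proof.
move=> zi A Ai; apply: big1 => j jA.
by rewrite zi ?scaler0 //; move: Ai; rewrite (cardsD1 j) jA.
Qed.

Lemma kd_comb (a b : R) z u A :
  kd (fun B => a *: z B + b *: u B) A = a *: kd z A + b *: kd u A.
Proof.
rewrite !scaler_sumr -big_split; apply: eq_bigr => j _ /=.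
by rewrite scalerDr !scalerA mulrC [_ * b]mulrC.
Qed.

Lemma kdB z u A : kd (fun B => z B - u B) A = kd z A - kd u A.
Proof.
have := kd_comb 1 (-1) z u A; rewrite scale1r scaleN1r => <-.
by apply: eq_bigr => j _; rewrite scale1r scaleN1r.
Qed.

Lemma eq_kd z u : z =1 u -> kd z =1 kd u.
Proof. by move=> zu A; apply: eq_bigr => j _; rewrite zu. Qed.

Lemma kdZ a z A : kd (fun B => a *: z B) A = a *: kd z A.
Proof.
have := kd_comb a 0 z z A; rewrite scale0r addr0 => <-.
by apply: eq_kd => B; rewrite scale0r addr0.
Qed.

Lemma kdK z A : kd (kd z) A = 0.
Proof.
pose f (j l : 'I_n) : M := if (j \notin A) && (l \notin j |: A) then
  ((-1) ^+ (pos j A + pos l (j |: A)) * (x j * x l)) *: z (l |: (j |: A)) else 0.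
have fE j l : f j l = - f l j.
  rewrite /f !inE !negb_or (eq_sym l j); case: eqP => [|/eqP jl].
    by rewrite !andbF oppr0.
  case jA: (j \in A); rewrite ?andbF ?oppr0 //=.
  case lA: (l \in A); rewrite ?andbF ?oppr0 //=.
  by rewrite pos_swap ?jA ?lA // mulNr scaleNr setUCA (mulrC (x j)).
have -> : kd (kd z) A = \sum_j \sum_l f j l.
  rewrite /kd [LHS]big_mkcond; apply: eq_bigr => j _; rewrite /f.
  case jA: (j \notin A); last by rewrite big1.
  rewrite scaler_sumr [LHS]big_mkcond; apply: eq_bigr => l _ /=.
  case: ifP => // _; rewrite scalerA exprD; congr (_ *: _).
  by rewrite -!mulrA; congr (_ * _); rewrite mulrCA.
(* Antisymmetry of [f] alone shows only that twice the sum vanishes, which is void in characteristic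
   2; the terms with l < j are matched with those with l > j instead. *)
have split_lt j : \sum_l f j l =
    \sum_(l : 'I_n | (l < j)%N) f j l + \sum_(l : 'I_n | (j < l)%N) f j l.
  rewrite (bigID (fun l : 'I_n => (l < j)%N)) /=; congr (_ + _).
  rewrite (bigID (fun l => l == j)) /= [X in X + _]big1 => [|l /andP[_ /eqP->]].
    rewrite add0r; apply: eq_bigl => l; rewrite -leqNgt [RHS]ltn_neqAle eq_sym.
    by rewrite andbC.
  by rewrite /f !inE eqxx andbF.
under eq_bigr do rewrite split_lt.
rewrite big_split /= [X in X + _](exchange_big_dep xpredT) //= -big_split /=.
apply: big1 => j _; rewrite -big_split; apply: big1 => l _ /=.
by rewrite fE addNr.
Qed.

(** Wedging with a is a homotopy from 0 to multiplication by \sum_j a_j x_j. The diagonal terms add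
    up to the right-hand side; a term that inserts j and removes l cancels against its counterpart
    in the other order. *)
Lemma kd_ke a z A : kd (ke a z) A + ke a (kd z) A = (\sum_j a j * x j) *: z A.
Proof.
pose g (j l : 'I_n) : M := ((-1) ^+ (pos j A + pos l (j |: A)) * (x j * a l)) *:
   z ((j |: A) :\ l).
have -> : kd (ke a z) A = \sum_(j | j \notin A)
    ((a j * x j) *: z A + \sum_(l in A) g j l).
  apply: eq_bigr => j jA; rewrite /ke big_setU1 //= scalerDr; congr (_ + _).
    rewrite setU1K // scalerA posU1 // ltnn add0n.
    rewrite mulrACA -expr2 sqrr_sign mul1r mulrC.
    by [].
  rewrite scaler_sumr; apply: eq_bigr => l lA; rewrite scalerA /g exprD.
  by rewrite mulrACA.
have -> : ke a (kd z) A = \sum_(l in A)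
    ((a l * x l) *: z A - \sum_(j | j \notin A) g j l).
  apply: eq_bigr => l lA; rewrite /kd (bigD1 l) ?setD11 //= scalerDr.
  congr (_ + _).
    rewrite setD1K // scalerA (posD1 l lA) ltnn add0n.
    by rewrite mulrACA -expr2 sqrr_sign mul1r.
  rewrite scaler_sumr -sumrN; apply: eq_big => [j|j].
    rewrite !inE negb_and negbK; case: eqP => [->|_]; rewrite ?lA ?andbF ?andbT //.
  rewrite !inE negb_and negbK => /andP[/orP[->//|jA] jl].
  rewrite scalerA /g -scaleNr; congr (_ *: z _); last first.
    apply/setP => i; rewrite !inE; case: (altP (i =P j)) => [->|_] //=.
    by rewrite jl.
  rewrite mulrACA -exprD -mulNr; congr (_ * _); last by rewrite mulrC.
  rewrite (posU1 l jA) (posD1 j lA) (posD1 l lA) ltnn add0n.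
  by case: (ltngtP j l) jl => [_ _|_ _|/val_inj ->]; rewrite ?eqxx //=
    ?add0n ?add1n ?addn0 ?addSn ?addnS exprS mulN1r ?opprK addnC.
rewrite !big_split /= sumrN exchange_big /= addrACA subrr addr0.
by rewrite scaler_suml [RHS](bigID (mem A)) /= addrC.
Qed.

End Koszul.

(** * Vanishing of Koszul homology along a regular sequence *)

Section Acyclicity.
Variables (R : comNzRingType) (n : nat) (x : 'I_n -> R) (M : lmodType R).
(** [L k] stands for L_0 + (y_0, ..., y_(k-1)) M and [T] for a multiplicative set of denominators.
    The abstraction covers the variables acting on a free module, with trivial [T], and a sequence
    that is regular only in the localised Stanley-Reisner ring, with [L 0] its ideal. *)
Variables (T : R -> Prop) (r : nat) (y : nat -> R) (L : nat -> M -> Prop).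
Hypotheses (T1 : T 1) (TM : forall s t, T s -> T t -> T (s * t)).
Hypothesis L0 : forall k, L k 0.
Hypothesis LD : forall k v w, L k v -> L k w -> L k (v + w).
Hypothesis LZ : forall k a v, L k v -> L k (a *: v).
Hypothesis yx : forall k, (k < r)%N -> exists a, y k = \sum_j a j * x j.
Hypothesis LS : forall k v, (k < r)%N ->
  L k.+1 v <-> exists w, L k (v - y k *: w).
Hypothesis Lreg : forall k v, (k < r)%N -> L k (y k *: v) ->
  exists2 s, T s & L k (s *: v).

Lemma submod_sum k (I : finType) (P : pred I) (F : I -> M) :
  (forall i, P i -> L k (F i)) -> L k (\sum_(i | P i) F i).
Proof. by move=> LF; elim/big_rec: _ => // i v Pi Lv; apply: LD => //; apply: LF. Qed.

Lemma common_denominator k (I : finType) (F : I -> M) :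
  (forall i, exists2 s, T s & L k (s *: F i)) ->
  exists2 s, T s & forall i, L k (s *: F i).
Proof.
move=> LF; suff [s Ts sF] : exists2 s, T s & forall i, i \in enum I -> L k (s *: F i).
  by exists s => // i; apply: sF; rewrite mem_enum.
elim: (enum I) => [|i e [s Ts sF]]; first by exists 1.
have [t Tt tF] := LF i; exists (s * t); first exact: TM.
move=> j; rewrite inE => /orP[/eqP->|je]; first by rewrite -scalerA; apply: LZ.
by rewrite mulrC -scalerA; apply/LZ/sF.
Qed.

(* If H_{i+1} vanishes modulo L_{k+1} then H_i vanishes modulo L_k: for a cycle
   z modulo L_k, y_k z is the boundary of a wedge product u, which is a cycle
   modulo L_{k+1} = L_k + y_k M; applying the differential to s u = dw + y_k v
   and cancelling y_k shows that z is a boundary. *)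
Lemma koszul_acyclic k i z : (k <= r)%N -> (n + k < i + r)%N ->
  ksupp i z -> (forall A, L k (kd x z A)) ->
  exists2 s, T s & exists2 u, ksupp i.+1 u &
    forall A, L k (s *: z A - kd x u A).
Proof.
move=> kr; have [m def_m] : exists m, m = (r - k)%N by exists (r - k)%N.
elim: m k i z kr def_m => [|m IHm] k i z kr def_m ni zi zL.
  (* At k = r the bound reads n < i, and no subset of the n indices has i elements. *)
  exists 1 => //; exists (fun=> 0) => // A; rewrite scale1r zi.
    by rewrite /kd big1 ?subr0 // => j _; rewrite scaler0.
  by have := max_card A; rewrite card_ord; lia.
have {kr def_m} [kr def_m] : (k < r)%N /\ m = (r - k.+1)%N by lia.
have [a ya] := yx kr; pose u := ke a z.
have du A : kd x u A = y k *: z A - ke a (kd x z) A by rewrite ya -(kd_ke x) addrK.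
have keL A : L k (ke a (kd x z) A).
  by apply: submod_sum => j _; apply: LZ.
have duL A : L k.+1 (kd x u A).
  apply/LS => //; exists (z A); rewrite du addrAC subrr add0r -scaleN1r.
  exact: LZ.
have ni1 : (n + k.+1 < i.+1 + r)%N by lia.
have [s Ts [w wi wL]] := IHm k.+1 i.+1 u kr def_m ni1 (ke_supp a zi) duL.
have /choice[v vL] A : exists v, L k (s *: u A - kd x w A - y k *: v).
  by apply/LS.
pose v' := ktrunc i.+1 v.
have v'L A : L k (y k *: (s *: z A - kd x v' A)).
  have [Ai|Ai] := eqVneq #|A| i; last first.
    rewrite zi // (kd_supp x (@ktrunc_supp _ _ _ i.+1 v)) // scaler0 subr0 scaler0.
    exact: L0.
  rewrite scalerBr /v' kd_trunc //.
  have -> : y k *: (s *: z A) - y k *: kd x v A =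
      kd x (fun B => s *: u B - kd x w B - y k *: v B) A + s *: ke a (kd x z) A.
    rewrite !kdB kdK subr0 !kdZ.
    by rewrite du scalerBr !scalerA [RHS]addrAC subrK (mulrC s).
  apply: LD; last exact: LZ.
  by apply: submod_sum => j _; apply: LZ.
have [t Tt tL] : exists2 t, T t & forall A, L k (t *: (s *: z A - kd x v' A)).
  by apply: common_denominator => A; apply: Lreg.
exists (t * s); first exact: TM.
exists (fun A => t *: v' A) => [A Ai|A].
  by rewrite /v' (ktrunc_supp v Ai) scaler0.
by rewrite kdZ -scalerA -scalerBr.
Qed.

End Acyclicity.

(** * Monomial coefficients and killing of variables *)

Section Monomials.
Variables (K : fieldType) (n : nat).
Local Notation S := {mpoly K[n]}.
Implicit Types (p q : S) (m : 'X_{1..n}) (A B : {set 'I_n}).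

Lemma mcoeffXM (j : 'I_n) p m :
  ('X_j * p)@_m = if (0 < m j)%N then p@_(m - U_(j))%MM else 0.
Proof.
case: ifP => [mj|/negbT mj].
  have Um : (U_(j) <= m)%MM.
    by apply/mnm_lepP => i; rewrite mnm1E; case: eqP => // <-.
  by rewrite -{1}(submK Um) addmC mulrC mcoeffMX.
rewrite [p]mpolyE mulr_sumr raddf_sum /= big1 // => k _.
rewrite -scalerAr -mpolyXD mcoeffZ mcoeffX; case: eqP => [km|]; last by rewrite mulr0.
by move: mj; rewrite -km mnmDE mnm1E eqxx.
Qed.

Lemma mdivX (j : 'I_n) p : (forall m, m j = 0%N -> p@_m = 0) ->
  exists q, p = 'X_j * q.
Proof.
move=> p0; exists (\sum_(m <- msupp p) p@_m *: 'X_[(m - U_(j))%MM]).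
rewrite mulr_sumr [LHS]mpolyE; apply: eq_big_seq => m; rewrite mcoeff_msupp.
move=> pm; rewrite -scalerAr -mpolyXD addmC submK //.
apply/mnm_lepP => i; rewrite mnm1E; case: eqP => // <-.
by rewrite lt0n; apply: contraNneq pm => /p0 ->.
Qed.

(* Substitution of 0 for the variables in B; its kernel is the prime generated
   by these variables. *)
Definition mkill B p : S := p \mPo [tuple if i \in B then 0 else 'X_i | i < n].

HB.instance Definition _ B := GRing.RMorphism.copy (mkill B)
  (comp_mpoly [tuple if i \in B then 0 else 'X_i | i < n]).

Lemma mkillXm B m :
  mkill B 'X_[m] = if [forall i in B, m i == 0%N] then 'X_[m] else 0.
Proof.
rewrite /mkill comp_mpolyX; case: ifP => [/forall_inP mB|].
  rewrite [RHS]mpolyXE_id; apply: eq_bigr => i _; rewrite tnth_mktuple.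
  by case: ifP => // /mB /eqP ->; rewrite !expr0.
move/negbT/forall_inPn => [i iB mi]; rewrite (bigD1 i) //= tnth_mktuple iB.
by rewrite expr0n (negPf mi) mul0r.
Qed.

Lemma mcoeff_kill B p m :
  (mkill B p)@_m = if [forall i in B, m i == 0%N] then p@_m else 0.
Proof.
rewrite {1}[p]mpolyE /mkill rmorph_sum /= raddf_sum /=.
under eq_bigr => k _ do rewrite comp_mpolyZ -[_ \mPo _]/(mkill B _) mkillXm mcoeffZ.
have F0 k : k != m -> p@_k * (if [forall i in B, k i == 0%N] then 'X_[k] else 0)@_m = 0.
  by move=> /negPf km; case: ifP => _; rewrite ?mcoeff0 ?mcoeffX ?km mulr0.
have [mp|mp] := boolP (m \in msupp p).
  rewrite (bigD1_seq m) ?msupp_uniq //= [X in _ + X]big1 ?addr0 => [|k /F0 //].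
  case: ifP => _; last by rewrite mcoeff0 mulr0.
  by rewrite mcoeffX eqxx mulr1.
rewrite big_seq big1 => [|k kp]; last by apply: F0; apply: contraTneq kp => ->.
by rewrite (eqP (_ : p@_m == 0)) ?if_same // mcoeff_eq0.
Qed.

Lemma mkillK B p : mkill B (mkill B p) = mkill B p.
Proof. by apply/mpolyP => m; rewrite !mcoeff_kill; case: [forall _ in _, _]. Qed.

Lemma mkill_eq0P B p :
  mkill B p = 0 <-> (forall m, (forall i, i \in B -> m i = 0%N) -> p@_m = 0).
Proof.
split=> [p0 m mB|p0].
  have mB' : [forall i in B, m i == 0%N] by apply/forall_inP => i /mB ->.
  by have := mcoeff_kill B p m; rewrite p0 mcoeff0 mB'.
apply/mpolyP => m; rewrite mcoeff_kill mcoeff0; case: ifP => // /forall_inP mB.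
by apply: p0 => i /mB /eqP.
Qed.

Lemma mkillT_eq0 p : mkill setT p = 0 <-> p@_0%MM = 0.
Proof.
rewrite mkill_eq0P; split=> [|p0 m m0]; first by apply=> i _; rewrite mnm0E.
by rewrite (_ : m = 0%MM) //; apply/mnmP => i; rewrite m0 ?mnm0E ?inE.
Qed.

Lemma mkill_eq0_sub A B p : A \subset B -> mkill A p = 0 -> mkill B p = 0.
Proof.
move=> /subsetP AB /mkill_eq0P pA; apply/mkill_eq0P => m mB.
by apply: pA => i /AB /mB.
Qed.

Lemma maximal_ideal_span p : p@_0%MM = 0 -> exists a : 'I_n -> S, p = \sum_j a j * 'X_j.
Proof.
move=> p0; suff [a pa] : exists a : 'I_n -> S, p - (p@_0%MM)%:MP = \sum_j a j * 'X_j.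
  by exists a; rewrite -pa p0 mpolyC0 subr0.
elim/mpolyind: {p0} p => [|c m p _ _ [a pa]].
  exists (fun=> 0); rewrite mcoeff0 mpolyC0 subr0 big1 // => j _.
  by rewrite mul0r.
have [->|m0] := eqVneq m 0%MM.
  exists a; rewrite mpolyX0 mcoeffD mcoeffZ mcoeff1 eqxx mulr1 mpolyCD.
  by rewrite -pa -alg_mpolyC opprD addrACA subrr add0r.
have [j mj] : exists j, m j != 0%N.
  apply/existsP; apply: contraR m0 => /existsPn m0; apply/eqP/mnmP => i.
  by rewrite mnm0E; apply/eqP; rewrite -[_ == _]negbK.
exists (fun i => a i + if i == j then c *: 'X_[(m - U_(j))%MM] else 0).
under eq_bigr do rewrite mulrDl.
rewrite big_split /= -pa (bigD1 j) //= eqxx [X in _ + (_ + X)]big1 => [|i /negPf->].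
  rewrite addr0 -scalerAl -mpolyXD submK; last first.
    by apply/mnm_lepP => i; rewrite mnm1E; case: eqP => // <-; rewrite lt0n.
  by rewrite mcoeffD mcoeffZ mcoeffX (negPf m0) mulr0 add0r -addrA addrC.
by rewrite mul0r.
Qed.

End Monomials.

Section PolynomialKoszul.
Variables (K : fieldType) (n N r : nat).
Local Notation S := {mpoly K[n]}.
Local Notation X := (fun i : 'I_n => 'X_i : S).

(** The case of [koszul_acyclic] in which y runs through all the variables: its sequence has length
    n, so at k = 0 the bound is just 0 < i. The submodule (x_0, ..., x_(k-1)) is given as a kernel
    of [mkill], which turns membership into a condition on coefficients. *)
Lemma koszul_exact i (z : {set 'I_n} -> 'M[S]_(N, r)) : (0 < i)%N ->
  ksupp i z -> (forall A, kd X z A = 0) ->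
  exists2 u, ksupp i.+1 u & forall A, z A = kd X u A.
Proof.
move=> i0 zi zd; pose B k := [set j : 'I_n | (j < k)%N].
pose L k (Z : 'M[S]_(N, r)) := forall a b, mkill (B k) (Z a b) = 0.
pose y k : S := oapp X 0 (insub k).
have yE k (kn : (k < n)%N) : y k = 'X_(Ordinal kn) by rewrite /y insubT.
have B0 p : mkill (B 0%N) p = p.
  apply/mpolyP => m; rewrite mcoeff_kill ifT //.
  by apply/forall_inP => j; rewrite inE ltn0.
have L00 Z : L 0%N Z -> Z = 0.
  by move=> LZ; apply/matrixP => a b; have := LZ a b; rewrite B0 mxE.
have [|||||||||||s <- [u ui uz]] := @koszul_acyclic S n X 'M[S]_(N, r) (eq 1) n y L
  _ _ _ _ _ _ _ _ 0%N i z _ _ zi.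
- by [].
- by move=> s t <- <-; rewrite mulr1.
- by move=> k a b; rewrite mxE rmorph0.
- by move=> k v w Lv Lw a b; rewrite mxE rmorphD /= Lv Lw addr0.
- by move=> k c v Lv a b; rewrite mxE rmorphM /= Lv mulr0.
- move=> k kn; exists (fun j => (j == Ordinal kn)%:R); rewrite yE.
  by rewrite (bigD1 (Ordinal kn)) //= eqxx mul1r big1 ?addr0 // => j /negPf->; rewrite mul0r.
- move=> k v kn; split=> [Lv|[w Lw] a b].
    have /choice[f fE] (ab : 'I_N * 'I_r) : exists q,
        mkill (B k) (v ab.1 ab.2) = 'X_(Ordinal kn) * q.
      apply: mdivX => m mk; rewrite mcoeff_kill; case: ifP => // /forall_inP mB.
      have /mkill_eq0P := Lv ab.1 ab.2; apply=> j; rewrite inE ltnS leq_eqVlt.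
      by case/orP => [/eqP jk|jk]; [rewrite -[RHS]mk; congr (m _); apply: val_inj
        | apply/eqP/mB; rewrite inE].
    exists (\matrix_(a, b) f (a, b)) => a b; rewrite !mxE yE.
    by rewrite -(fE (a, b)) rmorphB /= mkillK subrr.
  apply/mkill_eq0P => m mB.
  have /mkill_eq0P := Lw a b; rewrite !mxE => /(_ m).
  rewrite mcoeffB yE mcoeffXM mB ?inE //= subr0; apply=> j; rewrite inE => jk.
  by apply: mB; rewrite inE ltnW.
- move=> k v kn Lv; exists 1 => // a b; rewrite mxE mul1r.
  apply/mkill_eq0P => m mB.
  have /mkill_eq0P := Lv a b; rewrite mxE yE => /(_ (m + U_(Ordinal kn))%MM).
  rewrite mcoeffXM mnmDE mnm1E eqxx addn1 /= addmK; apply=> j jB.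
  rewrite mnmDE mB // mnm1E; case: eqP => // jk.
  by move: jB; rewrite inE -jk ltnn.
- by rewrite leq0n.
- by rewrite addn0 -[X in (X < _)%N]add0n ltn_add2r.
- by move=> A; rewrite zd => a b; rewrite mxE rmorph0.
- exists u => // A; apply/eqP; rewrite -subr_eq0; apply/eqP/L00.
  by have := uz A; rewrite scale1r.
Qed.

End PolynomialKoszul.

(** * Homogeneous components in integer degrees *)

Section Homogeneity.
Variables (K : fieldType) (n : nat).
Local Notation S := {mpoly K[n]}.
Implicit Types (e f : int) (p q : S).

Lemma zhomog_coeff e p :
  zhomog e p <-> (forall m, p@_m != 0 -> (mdeg m)%:Z = e).
Proof.
case: e => d /=; split.
- by move=> /dhomogP pd m; rewrite -mcoeff_msupp => /pd ->.
- by move=> pd; apply/dhomogP => m; rewrite mcoeff_msupp => /pd [].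
- by move=> -> m; rewrite mcoeff0 eqxx.
- by move=> pd; apply/mpolyP => m; rewrite mcoeff0; apply/eqP; apply: contraTT isT => /pd.
Qed.

Definition zpi e p : S := if e is Posz d then pihomog mdeg d p else 0.

Lemma mcoeff_zpi e p m : (zpi e p)@_m = if (mdeg m)%:Z == e then p@_m else 0.
Proof.
case: e => d; rewrite /zpi ?mcoeff0 // pihomogE raddf_sum /=.
have F0 k : k != m -> (p@_k *: 'X_[k])@_m = 0.
  by move=> /negPf km; rewrite mcoeffZ mcoeffX km mulr0.
have [mp|mp] := boolP (m \in msupp p); last first.
  rewrite big_seq_cond big1 => [|k /andP[kp _]]; last by apply: F0; apply: contraTneq kp => ->.
  by rewrite (eqP (_ : p@_m == 0)) ?if_same // mcoeff_eq0.
rewrite big_mkcond (bigD1_seq m) ?msupp_uniq //= [X in _ + X]big1 => [|k /F0 ->].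
  rewrite addr0; case: ifP => [/eqP->|/eqP md]; last by case: eqP => // -[].
  by rewrite mcoeffZ mcoeffX !eqxx mulr1.
exact: if_same.
Qed.

Lemma zpi_homog e p : zhomog e (zpi e p).
Proof.
by apply/zhomog_coeff => m; rewrite mcoeff_zpi; case: ifP => [/eqP|_]; rewrite ?eqxx.
Qed.

Lemma zpi_id e p : zhomog e p -> zpi e p = p.
Proof.
move/zhomog_coeff => pe; apply/mpolyP => m; rewrite mcoeff_zpi; case: eqP => // me.
by apply/esym/eqP; apply: contraTT isT => /pe.
Qed.

Lemma zpi_sum e (I : finType) (P : pred I) (G : I -> S) :
  zpi e (\sum_(i | P i) G i) = \sum_(i | P i) zpi e (G i).
Proof.
apply/mpolyP => m; rewrite mcoeff_zpi !(raddf_sum (mcoeff m)).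
case: ifP => me; [apply: eq_bigr | apply/esym/big1] => i _; by rewrite /= mcoeff_zpi me.
Qed.

Lemma zpiM e f p q : zhomog f q -> zpi (e + f) (p * q) = zpi e p * q.
Proof.
move/zhomog_coeff => qf; apply/mpolyP => m; rewrite mcoeff_zpi !mcoeffM.
transitivity (\sum_(k : 'X_{1..n < (mdeg m).+1, (mdeg m).+1} | m == (k.1 + k.2)%MM)
  (if (mdeg m)%:Z == e + f then p@_k.1 * q@_k.2 else 0)).
  by case: ifP => // _; rewrite big1.
apply: eq_bigr => k /eqP mk; rewrite mcoeff_zpi.
have [->|/qf qk] := eqVneq (q@_k.2) 0; first by rewrite !mulr0 if_same.
have := congr1 (fun m => (mdeg m)%:Z) mk; rewrite mdegD PoszD qk => ->.
rewrite (inj_eq (addIr f)).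
by case: ifP => // _; rewrite mul0r.
Qed.

Lemma zhomog0 e : zhomog e (0 : S).
Proof. by apply/zhomog_coeff => m; rewrite mcoeff0 eqxx. Qed.

Lemma zhomogD e p q : zhomog e p -> zhomog e q -> zhomog e (p + q).
Proof.
move=> /zhomog_coeff pe /zhomog_coeff qe; apply/zhomog_coeff => m.
have [p0|/pe //] := eqVneq p@_m 0.
by rewrite mcoeffD p0 add0r => /qe.
Qed.

Lemma zhomogM e f p q : zhomog e p -> zhomog f q -> zhomog (e + f) (p * q).
Proof.
by move=> pe qf; rewrite -(zpi_id pe) -(zpiM e p qf); apply: zpi_homog.
Qed.

Lemma zhomogC c : zhomog 0 (c%:MP : S).
Proof.
apply/zhomog_coeff => m; rewrite mcoeffC; have [->|_] := eqVneq m 0%MM.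
  by rewrite mdeg0.
by rewrite mulr0 eqxx.
Qed.

Lemma zhomogCM e c p : zhomog e p -> zhomog e (c%:MP * p).
Proof. by rewrite -{2}[e]add0r; apply/zhomogM/zhomogC. Qed.

Lemma zhomogX m : zhomog (mdeg m)%:Z ('X_[m] : S).
Proof. by rewrite /= dhomogX. Qed.

Lemma zhomog_sum e (I : finType) (P : pred I) (G : I -> S) :
  (forall i, P i -> zhomog e (G i)) -> zhomog e (\sum_(i | P i) G i).
Proof.
by move=> Ge; elim/big_ind: _ => //; [apply: zhomog0 | move=> *; apply: zhomogD].
Qed.

End Homogeneity.

Section KoszulMatrix.
Variables (K : fieldType) (n : nat).
Local Notation S := {mpoly K[n]}.
Local Notation X := (fun i : 'I_n => 'X_i : S).

Lemma kd_mulmx N r s (z : {set 'I_n} -> 'M[S]_(N, r)) (B : 'M[S]_(r, s)) A :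
  kd X (fun C => z C *m B) A = kd X z A *m B.
Proof. by rewrite mulmx_suml; apply: eq_bigr => j _; rewrite scalemxAl. Qed.

Lemma mulmx_kd N N' r (z : {set 'I_n} -> 'M[S]_(N, r)) (a : 'M[S]_(N', N)) A :
  kd X (fun C => a *m z C) A = a *m kd X z A.
Proof. by rewrite mulmx_sumr; apply: eq_bigr => j _; rewrite scalemxAr. Qed.

Lemma kd_entry N r (z : {set 'I_n} -> 'M[S]_(N, r)) A a b :
  kd X z A a b = \sum_(j | j \notin A) (-1) ^+ pos j A * 'X_j * z (j |: A) a b.
Proof. by rewrite summxE; apply: eq_bigr => j _; rewrite mxE. Qed.

(* z is homogeneous of total degree e when the basis element e_A has degree #|A|
   and the b-th column degree dg b. *)
Definition khomog N r (dg : 'I_r -> int) (e : int)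
    (z : {set 'I_n} -> 'M[S]_(N, r)) :=
  forall (A : {set 'I_n}) a b, zhomog (e - #|A|%:Z - dg b) (z A a b).

Lemma khomog_kd N r (dg : 'I_r -> int) e (z : {set 'I_n} -> 'M[S]_(N, r)) :
  khomog dg e z -> khomog dg e (kd X z).
Proof.
move=> ze A a b; rewrite kd_entry; apply: zhomog_sum => j jA.
have -> : e - #|A|%:Z - dg b = 1 + (e - #|j |: A|%:Z - dg b).
  by rewrite cardsU1 jA; lia.
apply: zhomogM => //; rewrite -[1]add0r; apply: zhomogM; last first.
  by have := zhomogX K (U_(j)%MM : 'X_{1..n}); rewrite mdeg1.
rewrite -signr_odd; case: odd; rewrite ?expr1 ?expr0.
  by rewrite -(mpolyC1 n K) -mpolyCN; apply: zhomogC.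
by rewrite -(mpolyC1 n K); apply: zhomogC.
Qed.

Definition kproj N r (dg : 'I_r -> int) e (z : {set 'I_n} -> 'M[S]_(N, r)) (A : {set 'I_n}) :=
  \matrix_(a, b) zpi (e - #|A|%:Z - dg b) (z A a b).

Lemma kproj_homog N r (dg : 'I_r -> int) e (z : {set 'I_n} -> 'M[S]_(N, r)) :
  khomog dg e (kproj dg e z).
Proof. by move=> A a b; rewrite mxE; apply: zpi_homog. Qed.

(** Since [B] preserves degrees, an arbitrary preimage of a homogeneous chain may be replaced by its
    component of the right degree. *)
Lemma kproj_mulmx N r s (dr : 'I_r -> int) (ds : 'I_s -> int) (B : 'M[S]_(r, s)) e
    (z : {set 'I_n} -> 'M[S]_(N, r)) (w : {set 'I_n} -> 'M[S]_(N, s)) :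
  (forall u v, zhomog (dr u - ds v) (B u v)) -> khomog ds e w ->
  forall A, w A = z A *m B -> w A = kproj dr e z A *m B.
Proof.
move=> Bh wh A wz; apply/matrixP => a b; rewrite -(zpi_id (wh A a b)) wz !mxE zpi_sum.
apply: eq_bigr => u _; rewrite mxE -(zpiM _ _ (Bh u b)).
by congr zpi; lia.
Qed.

Lemma kproj_supp N r (dg : 'I_r -> int) e i (z : {set 'I_n} -> 'M[S]_(N, r)) :
  ksupp i z -> ksupp i (kproj dg e z).
Proof.
move=> zi A Ai; apply/matrixP => a b; rewrite !mxE zi // mxE.
by apply/mpolyP => m; rewrite mcoeff_zpi mcoeff0 if_same.
Qed.

End KoszulMatrix.

(** * Comparison of a free resolution with the Koszul complex *)

Section Comparison.
Variables (K : fieldType) (n : nat).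
Local Notation S := {mpoly K[n]}.
Local Notation X := (fun i : 'I_n => 'X_i : S).
Local Notation cst := (map_mx (@mpolyC n K)).

Lemma lift_rows N r s (W : 'M[S]_(N, s)) (B : 'M[S]_(r, s)) :
  (forall a, exists z : 'rV_r, row a W = z *m B) -> exists Z, W = Z *m B.
Proof.
move=> /choice[f fE]; exists (\matrix_a f a).
by apply/row_matrixP => a; rewrite row_mul rowK fE.
Qed.

Lemma kd_onto_maximal N r (Z : 'M[S]_(N, r)) : map_mx (mcoeff 0%MM) Z = 0 ->
  exists2 u, ksupp 1 u & Z = kd X u set0.
Proof.
move=> Z0; have /choice[f fE] (ab : 'I_N * 'I_r) : exists a : 'I_n -> S,
    Z ab.1 ab.2 = \sum_j a j * 'X_j.
  by apply: maximal_ideal_span; have /matrixP/(_ ab.1 ab.2) := Z0; rewrite !mxE.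
exists (ktrunc 1 (fun A => \sum_(j in A) \matrix_(a, b) f (a, b) j)).
  exact: ktrunc_supp.
rewrite kd_trunc ?cards0 //; apply/matrixP => a b; rewrite (fE (a, b)) kd_entry.
apply: eq_big => [j|j _]; first by rewrite inE.
rewrite /pos (_ : [set k in _ | _] = set0) ?cards0; last by apply/setP => k; rewrite !inE.
by rewrite expr0 mul1r setU0 big_set1 mxE mulrC.
Qed.

Lemma mulmx_cst N r (Z : 'M[S]_(N, r)) s (B : 'M[S]_(r, s)) :
  map_mx (mcoeff 0%MM) (Z *m B) = map_mx (mcoeff 0%MM) Z *m map_mx (mcoeff 0%MM) B.
Proof. exact: map_mxM. Qed.

Lemma map_mx_cstK N r (a : 'M[K]_(N, r)) : map_mx (mcoeff 0%MM) (cst a) = a.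
Proof. by apply/matrixP => i j; rewrite !mxE mcoeffC eqxx mulr1. Qed.

Lemma kd_cst N r (u : {set 'I_n} -> 'M[S]_(N, r)) A : map_mx (mcoeff 0%MM) (kd X u A) = 0.
Proof.
apply/matrixP => a b; rewrite !mxE kd_entry raddf_sum big1 // => j _.
by rewrite /= !rmorphM /= mcoeffX mnm1_eq0 mulr0 mul0r.
Qed.

Variables (I : S -> Prop) (F : gfree_resolution I).
Hypothesis I_cst : forall p, I p -> p@_0%MM = 0.
Local Notation dgr q := (@deg _ _ _ F q).

Lemma diff_diff q : diff F q.+1 *m diff F q = 0.
Proof.
apply/row_matrixP => u; rewrite row0 rowE mulmxA; apply/exactS.
by exists (delta_mx 0 u).
Qed.

Lemma mx_exactS N q (W : 'M[S]_(N, rk F q.+1)) :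
  W *m diff F q = 0 -> exists Z, W = Z *m diff F q.+1.
Proof.
by move=> W0; apply: lift_rows => a; apply/exactS; rewrite -row_mul W0 row0.
Qed.

Lemma mx_exact0 N (W : 'M[S]_(N, rk F 0)) :
  (forall a, I ((W *m aug F) a 0)) -> exists Z, W = Z *m diff F 0.
Proof.
move=> WI; apply: lift_rows => a; apply/exact0.
by rewrite -row_mul mxE.
Qed.

Lemma cst_strand N q e (Z : 'M[S]_(N, rk F q)) :
  (forall a u, zhomog (e - dgr q u) (Z a u)) ->
  (map_mx (mcoeff 0%MM) Z <= tor_strand F q e)%MS.
Proof.
move=> Zh; apply/submxP; exists (map_mx (mcoeff 0%MM) Z).
apply/matrixP => a u; rewrite mul_mx_diag !mxE.
have [->|Z0] := eqVneq ((Z a u)@_0%MM) 0; first by rewrite mul0r.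
have /zhomog_coeff/(_ _ Z0)/esym/eqP := Zh a u.
by rewrite mdeg0 subr_eq0 => /eqP ->; rewrite eqxx mulr1.
Qed.

Lemma zigzag p : forall q r N e (z : {set 'I_n} -> 'M[S]_(N, rk F q.+1)) z',
  r = (q.+1 + p)%N -> ksupp p z -> khomog (dgr q.+1) e z ->
  (forall A, z A *m diff F q = kd X z' A) ->
  exists C : 'M[K]_(N, rk F r), [/\ (C <= tor_cycles F r)%MS,
    (C <= tor_strand F r e)%MS
  & forall N' (a : 'M[K]_(N', N)), (a *m C <= diffK F r)%MS ->
    exists2 u, ksupp p.+1 u &
      exists v, forall A, cst a *m z A = kd X u A + v A *m diff F q.+1].
Proof.
elim: p => [|p IHp] q r N e z z' ->.
  rewrite addn0 => z0 ze zz'; exists (map_mx (mcoeff 0%MM) (z set0)); split.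
  - by apply/sub_kermxP; rewrite /diffK -mulmx_cst zz' kd_cst.
  - by apply: cst_strand => a u; have := ze set0 a u; rewrite cards0 subr0.
  move=> N' a /submxP[b ab].
  have [|u u1 uE] := @kd_onto_maximal _ _ (cst a *m z set0 - cst b *m diff F q.+1).
    rewrite map_mxB !mulmx_cst !map_mx_cstK.
    by rewrite ab subrr.
  exists u => //; exists (fun A => if A == set0 then cst b else 0) => A.
  case: eqP => [->|/eqP A0]; first by rewrite -uE subrK.
  by rewrite mul0mx addr0 (kd_supp X u1) ?z0 ?mulmx0 // cards_eq0.
move=> zi ze zz'.
have kzi := kd_supp X zi.
have /choice[y0 y0E] A : exists Z, kd X z A = Z *m diff F q.+1.
  apply: mx_exactS; rewrite -kd_mulmx; have /eq_kd -> := zz'; exact: kdK.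
pose y1 := ktrunc p y0.
have y1E A : kd X z A = y1 A *m diff F q.+1.
  by rewrite /y1 /ktrunc; case: eqP => [_|/eqP Ap]; [exact: y0E | by rewrite mul0mx kzi].
pose y := kproj (dgr q.+2) e y1.
have yE A : y A *m diff F q.+1 = kd X z A.
  apply/esym; apply: (kproj_mulmx _ (khomog_kd ze) (y1E A)) => u v.
  exact: diff_homog.
have yp : ksupp p y by apply/kproj_supp/ktrunc_supp.
have ye : khomog (dgr q.+2) e y by apply: kproj_homog.
have [C [Ccyc Cstr CE]] := IHp q.+1 _ N e y z (esym (addSnnS q.+1 p)) yp ye yE.
exists C; split=> // N' a /CE[u up [v uv]].
pose w A := cst a *m z A - u A *m diff F q.+1.
have [|A|w' w's w'E] := @koszul_exact K n N' (rk F q.+1) p.+1 w isT.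
- by move=> A Ap; rewrite /w zi // up // mulmx0 mul0mx subrr.
- rewrite kdB mulmx_kd -yE kd_mulmx mulmxA uv mulmxDl addrAC subrr add0r.
  by rewrite -mulmxA diff_diff mulmx0.
by exists w' => //; exists u => A; rewrite -w'E subrK.
Qed.

(** A preimage of 1 modulo I maps to a polynomial with constant term 1, because I has no constant
    terms; its degree 0 part therefore maps to 1 exactly. Multiplication by w then lifts chains over
    S to chains over F_0. *)
Lemma aug_section : exists2 w : 'rV[S]_(rk F 0),
  forall u, zhomog (- dgr 0 u) (w 0 u) & w *m aug F = 1%:M.
Proof.
have [w0 w0I] := aug_surj F.
pose z (A : {set 'I_n}) := w0.
exists (kproj (dgr 0) 0 z set0) => [u|].
  by have := kproj_homog (dgr 0) 0 z set0 0 u; rewrite cards0 subr0 sub0r.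
apply/matrixP => a b; rewrite !ord1 !mxE eqxx.
have := I_cst w0I; rewrite mcoeffB mcoeff1 eqxx => /eqP; rewrite subr_eq0 => /eqP w01.
transitivity (zpi 0 ((w0 *m aug F) 0 0)).
  rewrite mxE zpi_sum; apply: eq_bigr => u _; rewrite mxE cards0 subr0 sub0r.
  by rewrite -(zpiM _ _ (aug_homog u)) addNr.
apply/mpolyP => m; rewrite mcoeff_zpi mcoeff1.
have [->|m0] := eqVneq m 0%MM; first by rewrite mdeg0 w01.
by case: ifP => // /eqP[/eqP]; rewrite mdeg_eq0 (negPf m0).
Qed.

(** The outermost step of the chase is separate, since S/I is given by a membership predicate and
    not by a matrix: the cycle modulo I is lifted to F_0 along the section of [aug], and [zigzag]
    takes over from F_1. *)
Lemma koszul_to_tor p N e (z : {set 'I_n} -> 'cV[S]_N) :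
  (0 < p)%N -> ksupp p z -> khomog (fun=> 0) e z ->
  (forall A a, I (kd X z A a 0)) ->
  exists C : 'M[K]_(N, rk F p), [/\ (C <= tor_cycles F p)%MS,
    (C <= tor_strand F p e)%MS
  & forall N' (a : 'M[K]_(N', N)), (a *m C <= diffK F p)%MS ->
    exists2 u, ksupp p.+1 u &
      forall A b, I ((cst a *m z A - kd X u A) b 0)].
Proof.
case: p => // p _ zp ze zI; have [w0 w0h w01] := aug_section.
pose z0 A : 'M_(N, rk F 0) := z A *m w0.
have z0p : ksupp p.+1 z0 by move=> A Ap; rewrite /z0 zp // mul0mx.
have z0e : khomog (dgr 0) e z0.
  move=> A a u; rewrite mxE big_ord1; apply: zhomogM => //.
  by have := ze A a 0; rewrite subr0.
have /choice[y0 y0E] A : exists Z, kd X z0 A = Z *m diff F 0.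
  apply: mx_exact0 => a.
  by rewrite kd_mulmx -mulmxA w01 mulmx1.
pose y1 := ktrunc p y0.
have y1E A : kd X z0 A = y1 A *m diff F 0.
  rewrite /y1 /ktrunc; case: eqP => [_|/eqP Ap]; [exact: y0E | rewrite mul0mx].
  exact: (kd_supp X z0p).
pose y := kproj (dgr 1) e y1.
have yE A : y A *m diff F 0 = kd X z0 A.
  apply/esym; apply: (kproj_mulmx _ (khomog_kd z0e) (y1E A)) => u v.
  exact: diff_homog.
have yp : ksupp p y by apply/kproj_supp/ktrunc_supp.
have ye : khomog (dgr 1) e y by apply: kproj_homog.
have [C [Ccyc Cstr CE]] := zigzag (esym (add1n p)) yp ye yE.
exists C; split=> // N' a /CE[u up [v uv]].
pose w A := cst a *m z0 A - u A *m diff F 0.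
have [|A|w' w's w'E] := @koszul_exact K n N' (rk F 0) p.+1 w isT.
- by move=> A Ap; rewrite /w z0p // up // mulmx0 mul0mx subrr.
- rewrite kdB mulmx_kd -yE kd_mulmx mulmxA uv mulmxDl addrAC subrr add0r.
  by rewrite -mulmxA diff_diff mulmx0.
exists (fun A => w' A *m aug F) => [A Ap|A b]; first by rewrite w's ?mul0mx.
have za : cst a *m z0 A *m aug F = cst a *m z A by rewrite /z0 -!mulmxA w01 mulmx1.
rewrite kd_mulmx -w'E /w mulmxBl za opprB addrC subrK.
have := (exact0 (row b (u A *m diff F 0))).2; rewrite -row_mul mxE; apply.
by exists (row b (u A)); rewrite row_mul.
Qed.

End Comparison.

(** * Dimension counts for Tor *)

Section TorDimensions.
Variables (K : fieldType) (n : nat) (I : {mpoly K[n]} -> Prop) (F : gfree_resolution I).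

Lemma diffK_cycles p : (diffK F p <= tor_cycles F p)%MS.
Proof.
case: p => [|p]; first exact: submx1.
by apply/sub_kermxP; rewrite /diffK -map_mxM diff_diff map_mx0.
Qed.

(** With cycles Z, boundaries B and strand E, the quotient of Z :&: E by B :&: E embeds in Z/B; the
    ranks are compared through the sum and the intersection of Z :&: E and B. *)
Lemma tor_gdim_le p e : (tor_gdim F p e <= tor_dim F p)%N.
Proof.
have dc := diffK_cycles p.
set Z := tor_cycles F p in dc *; set B := diffK F p in dc *.
set E := tor_strand F p e.
rewrite /tor_gdim /tor_dim -/Z -/B -/E leq_subLR addnBA ?mxrankS //.
rewrite -(leq_add2r (\rank B)) subnK; last first.
  by apply: leq_trans (leq_addl _ _); apply: mxrankS.
rewrite -mxrank_sum_cap addnC leq_add //.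
  by apply: mxrankS; rewrite sub_capmx capmxSr (submx_trans (capmxSl _ _) (capmxSr _ _)).
by apply: mxrankS; rewrite addsmx_sub capmxSl.
Qed.

Lemma tor_gdim_eq0 p e : tor_gdim F p e = 0%N ->
  (tor_cycles F p :&: tor_strand F p e <= diffK F p)%MS.
Proof.
move=> /eqP; rewrite subn_eq0 => r_le.
have BZ : (diffK F p :&: tor_strand F p e <= tor_cycles F p :&: tor_strand F p e)%MS.
  by apply: capmxS => //; apply: diffK_cycles.
have := mxrank_leqif_sup BZ; case=> le; rewrite eqn_leq le r_le => /esym ZB.
exact: submx_trans ZB (capmxSl _ _).
Qed.

Lemma tor_gdim_ge p e N (C : 'M[K]_(N, rk F p)) :
  (C <= tor_cycles F p)%MS -> (C <= tor_strand F p e)%MS ->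
  (forall a : 'rV_N, (a *m C <= diffK F p)%MS -> a = 0) -> (N <= tor_gdim F p e)%N.
Proof.
move=> Cc Cs C0; set B := (diffK F p :&: tor_strand F p e)%MS.
have CB : (C :&: B)%MS = 0.
  apply/eqP; rewrite -submx0; apply/row_subP => i.
  have : (row i (C :&: B) <= C :&: B)%MS by apply: row_sub.
  rewrite sub_capmx => /andP[/submxP[a ->] aB].
  by rewrite (C0 a) ?mul0mx ?sub0mx // (submx_trans aB) ?capmxSl.
have rC : \rank C = N.
  apply/eqP; rewrite -/(row_free C) -kermx_eq0; apply/rowV0P => a.
  by move/sub_kermxP => aC; apply: C0; rewrite aC sub0mx.
rewrite -rC /tor_gdim leq_subRL; last by apply/mxrankS/capmxS; rewrite ?diffK_cycles.
rewrite addnC -(mxrank_disjoint_sum CB); apply: mxrankS.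
rewrite addsmx_sub sub_capmx Cc Cs /=; apply: capmxS => //; apply: diffK_cycles.
Qed.

End TorDimensions.

(** * From the canonical module to Tor *)

Section AInvariant.
Variables (K : fieldType) (n : nat).
Local Notation S := {mpoly K[n]}.
Local Notation cst := (map_mx (@mpolyC n K)).

(** Membership in the k-th power of the irrelevant ideal, which measures the error in
    [cocycle_coboundary]. *)
Definition mord (k : nat) (p : S) := forall m : 'X_{1..n}, (mdeg m < k)%N -> p@_m = 0.

Lemma mordM k p q : p@_0%MM = 0 -> mord k q -> mord k.+1 (p * q).
Proof.
move=> p0 qk m mk; rewrite mcoeffM big1 // => -[u v] /= /eqP mE.
have [->|u0] := eqVneq (u : 'X_{1..n}) 0%MM; first by rewrite p0 mul0r.
rewrite qk ?mulr0 //; move: u0 mk; rewrite -mdeg_eq0.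
have := congr1 mdeg mE; rewrite mdegD; lia.
Qed.

Lemma mordCM k c p : mord k p -> mord k (c%:MP * p).
Proof. by move=> pk m mk; rewrite mcoeffCM pk ?mulr0. Qed.

Lemma mord_sum k (I : finType) (P : pred I) (G : I -> S) :
  (forall i, P i -> mord k (G i)) -> mord k (\sum_(i | P i) G i).
Proof. by move=> Gk m mk; rewrite raddf_sum big1 // => i Pi; apply: Gk. Qed.

Lemma mordD k p q : mord k p -> mord k q -> mord k (p + q).
Proof. by move=> pk qk m mk; rewrite mcoeffD pk ?qk ?addr0. Qed.

Lemma mord_mulmx k r s (Z : 'M[S]_(r, s)) (v : 'cV[S]_s) :
  map_mx (mcoeff 0%MM) Z = 0 -> (forall u, mord k (v u 0)) ->
  forall u, mord k.+1 ((Z *m v) u 0).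
Proof.
move=> Z0 vk u; rewrite mxE; apply: mord_sum => t _; apply: mordM => //.
by have /matrixP/(_ u t) := Z0; rewrite !mxE.
Qed.

(** As [A] links only equal degrees, the entries of [pinvmx A] between different degrees do not
    contribute to A Q A in matching degrees and can be erased. *)
Lemma degree_preserving_pinv r s (dr : 'I_r -> int) (ds : 'I_s -> int) (A : 'M[K]_(r, s)) :
  (forall u t, A u t != 0 -> dr u = ds t) ->
  exists2 Q : 'M[K]_(s, r), forall t u, Q t u != 0 -> dr u = ds t & A *m Q *m A = A.
Proof.
move=> Ah; pose Q := \matrix_(t, u) (if dr u == ds t then pinvmx A t u else 0).
exists Q => [t u|]; first by rewrite mxE; case: ifP => [/eqP|_]; rewrite ?eqxx.
rewrite -[RHS](mulmxKpV (submx_refl A)).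
apply/matrixP => u t; have [ut|/eqP ut] := eqVneq (dr u) (ds t).
  rewrite !mxE; apply: eq_bigr => w _.
  have [->|/Ah wt] := eqVneq (A w t) 0; first by rewrite !mulr0.
  congr (_ * _); rewrite !mxE; apply: eq_bigr => v _.
  have [->|/Ah uv] := eqVneq (A u v) 0; first by rewrite !mul0r.
  by rewrite mxE wt -ut uv eqxx.
rewrite mulmxKpV // [RHS](_ : _ = 0); last by apply: contra_notP ut => /eqP/Ah.
rewrite mxE big1 // => w _; have [->|/Ah wt] := eqVneq (A w t) 0; first by rewrite mulr0.
rewrite mxE big1 ?mul0r // => v _.
have [->|/Ah uv] := eqVneq (A u v) 0; first by rewrite mul0r.
by rewrite mxE -wt uv in ut *; case: eqP => [e|]; rewrite ?mulr0 //; case: ut.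
Qed.

(** [tor_strand] for a bare degree function. Together with matrices outside a resolution it lets
    [cocycle_coboundary] cover index 0, where [A] has no columns. *)
Definition degree_strand r (d : 'I_r -> int) e : 'M[K]_r := diag_mx (\row_u (d u == e)%:R).

(** Successive approximation replaces the passage to a minimal resolution: the error v - A w is
    pushed into ever higher powers of the irrelevant ideal, each time correcting w by Q applied to
    the error. *)
Lemma cocycle_coboundary r1 r0 r (B : 'M[S]_(r1, r0)) (A : 'M[S]_(r0, r))
    (d0 : 'I_r0 -> int) (d : 'I_r -> int) (v : 'cV[S]_r0) :
  (forall u t, zhomog (d0 u - d t) (A u t)) -> B *m A = 0 ->
  (forall e : int, n%:Z <= e -> (kermx (map_mx (mcoeff 0%MM) A)
      :&: degree_strand d0 e <= map_mx (mcoeff 0%MM) B)%MS) ->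
  (forall u, zhomog (d0 u - n%:Z) (v u 0)) -> B *m v = 0 ->
  exists2 w : 'cV[S]_r, forall t, zhomog (d t - n%:Z) (w t 0) & v = A *m w.
Proof.
set A0 := map_mx _ A; set B0 := map_mx _ B => Ah BA H vh Bv.
have A0h u t : A0 u t != 0 -> d0 u = d t.
  rewrite mxE => A0ut; have /zhomog_coeff/(_ _ A0ut) := Ah u t.
  by rewrite mdeg0 => /esym/eqP; rewrite subr_eq0 => /eqP.
have [Q Qh AQA] := degree_preserving_pinv A0h.
have hom_mul (w : 'cV[S]_r) : (forall t, zhomog (d t - n%:Z) (w t 0)) ->
    forall u, zhomog (d0 u - n%:Z) ((v - A *m w) u 0).
  move=> wh u; rewrite mxE; apply: zhomogD; first exact: vh.
  rewrite mxE mxE -sumrN; apply: zhomog_sum => t _; rewrite -mulNr.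
  have -> : d0 u - n%:Z = (d0 u - d t) + (d t - n%:Z) by rewrite addrA subrK.
  apply: zhomogM => //; rewrite -mulN1r -(mpolyC1 n K) -mpolyCN.
  exact: zhomogCM.
(* The entry at u of the error is homogeneous of degree d0 u - n; an order above all these degrees
   forces it to vanish. *)
suff /(_ (\max_u `|d0 u - n%:Z|%N).+1) [w wh wk] : forall k,
    exists2 w : 'cV[S]_r, forall t, zhomog (d t - n%:Z) (w t 0)
      & forall u, mord k ((v - A *m w) u 0).
  exists w => //; apply/eqP; rewrite -subr_eq0; apply/eqP/matrixP => u j.
  rewrite ord1 [RHS]mxE; apply/mpolyP => m; rewrite mcoeff0.
  have [//|mn0] := eqVneq ((v - A *m w) u 0)@_m 0.
  have /zhomog_coeff/(_ _ mn0) md := hom_mul _ wh u.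
  apply: wk; rewrite ltnS; apply: leq_trans (leq_bigmax u).
  by rewrite -md absz_nat.
elim=> [|k [w wh wk]].
  by exists 0 => // t; rewrite mxE; apply: zhomog0.
have v'h := hom_mul w wh; set v' := v - A *m w in wk v'h.
have Bv' : B *m v' = 0 by rewrite mulmxBr Bv mulmxA BA mul0mx subrr.
have Qvh t : zhomog (d t - n%:Z) ((cst Q *m v') t 0).
  rewrite mxE; apply: zhomog_sum => u _; rewrite mxE.
  have [->|/Qh <-] := eqVneq (Q t u) 0; first by rewrite mpolyC0 mul0r; apply: zhomog0.
  exact: zhomogCM.
have w'h t : zhomog (d t - n%:Z) ((w + cst Q *m v') t 0).
  by rewrite mxE; apply: zhomogD.
exists (w + cst Q *m v') => // u; have := hom_mul _ w'h u.
rewrite mulmxDr opprD addrA -/v' => v''h.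
(* Below degree n the entry is homogeneous of negative degree, hence 0; this is why H is required
   only for e at least n. *)
have [ule|ult] := lerP n%:Z (d0 u); last first.
  have neg : d0 u - n%:Z < 0 by rewrite subr_lt0.
  by move: v''h neg; case: (d0 u - n%:Z) => [k' _ //|k' -> _ m _]; rewrite mcoeff0.
have Qvk t : mord k ((cst Q *m v') t 0).
  by rewrite mxE; apply: mord_sum => u' _; rewrite mxE; apply: mordCM.
(* Row u of 1 - A0 Q is a cycle of degree d0 u, hence y B0. As B kills the error, y B0 acts on it as
   y (B0 - B), which has no constant terms and so raises the order. *)
pose rho := row u (1%:M - A0 *m Q).
have /submxP[y yE] : (rho <= B0)%MS.
  apply: submx_trans (H _ ule); rewrite sub_capmx; apply/andP; split.
    by apply/sub_kermxP; rewrite -row_mul mulmxBl mul1mx AQA subrr row0.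
  apply/submxP; exists rho; apply/rowP => t; rewrite mul_mx_diag [RHS]mxE [X in _ * X]mxE.
  have [_|d0ut] := eqVneq (d0 t) (d0 u); first by rewrite mulr1.
  rewrite mulr0 !mxE (_ : (u == t) = false); last by apply/eqP => ut; case/eqP: d0ut; rewrite ut.
  rewrite sub0r big1 ?oppr0 // => s _.
  have [->|/A0h us] := eqVneq (A0 u s) 0; first by rewrite mul0r.
  have [->|/Qh ts] := eqVneq (Q s t) 0; first by rewrite mulr0.
  by rewrite us ts eqxx in d0ut.
have -> : v' - A *m (cst Q *m v') =
    cst (1%:M - A0 *m Q) *m v' - (A - cst A0) *m (cst Q *m v').
  rewrite map_mxB map_mx1 map_mxM mulmxBl mul1mx mulmxBl opprB addrA.
  by rewrite -mulmxA subrK.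
rewrite mxE; apply: mordD; last first.
  rewrite mxE -mulN1r -(mpolyC1 n K) -mpolyCN; apply: mordCM.
  by apply: mord_mulmx => //; rewrite map_mxB map_mx_cstK subrr.
have -> : (cst (1%:M - A0 *m Q) *m v') u 0 = (cst y *m ((cst B0 - B) *m v')) 0 0.
  rewrite mulmxBl Bv' subr0 mulmxA -map_mxM -yE /rho map_row -row_mul.
  by rewrite [RHS]mxE.
rewrite mxE; apply: mord_sum => t _; rewrite mxE; apply: mordCM.
by apply: mord_mulmx => //; rewrite map_mxB map_mx_cstK subrr.
Qed.

Lemma ext_neq0_tor (I : S -> Prop) (F : gfree_resolution I) c :
  ext_neq0 F c 0 -> exists2 e : int, n%:Z <= e & tor_gdim F c e <> 0%N.
Proof.
case=> v [vh dv vB]; apply: contrapT => noe; case: vB.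
have H (e : int) : n%:Z <= e ->
    (tor_cycles F c :&: tor_strand F c e <= diffK F c)%MS.
  by move=> ne; apply: tor_gdim_eq0; apply: contrapT => ?; apply: noe; exists e.
have {}vh u : zhomog (deg u - n%:Z) (v u 0) by have := vh u; rewrite addr0.
case: c v vh dv H {noe} => [|c] v vh dv H /=.
  have [||e ne|//||w _ ->] := @cocycle_coboundary _ _ 0 (diff F 0) 0 (@deg _ _ _ F 0) (fun=> 0) v.
  - by move=> u [].
  - by rewrite mulmx0.
  - by apply: submx_trans (H e ne); apply: capmxS (submx_refl _); apply: submx1.
  - by [].
  by apply/matrixP => i j; rewrite !mxE big_ord0.
have [|||||w wh ->] := @cocycle_coboundary _ _ _ (diff F c.+1) (diff F c)
  (@deg _ _ _ F c.+1) (@deg _ _ _ F c) v => //.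
- exact: diff_homog.
- exact: diff_diff.
by exists w => // t; have := wh t; rewrite addr0.
Qed.

End AInvariant.

(** * The Stanley-Reisner ring *)

Section IdealGen.
Variable R : comNzRingType.
Implicit Types (s : seq R) (a b : R) (G : R -> Prop).

Lemma ideal_gen_ideal G : is_ideal (ideal_gen G).
Proof.
split=> [|a b [s sG ->] [t tG ->]|a b [s sG ->]].
- by exists [::] => //; rewrite big_nil.
- by exists (s ++ t) => [cg|]; rewrite ?big_cat // mem_cat => /orP[/sG|/tG].
exists [seq (a * cg.1, cg.2) | cg <- s] => [cg /mapP[cg' /sG ? ->] //|].
by rewrite big_map mulr_sumr; apply: eq_bigr => cg _; rewrite mulrA.
Qed.

Lemma ideal_gen_nil a : ideal_gen (fun x => x \in [::]) a -> a = 0.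
Proof.
case=> -[|cg t] tG ->; first by rewrite big_nil.
by have := tG cg (mem_head _ _).
Qed.

Lemma ideal_gen_rcons s y a :
  ideal_gen (fun x => x \in rcons s y) a <->
  exists b, ideal_gen (fun x => x \in s) (a - y * b).
Proof.
split=> [[t tG ->]|[b [t tG ab]]]; last first.
  exists (rcons t (b, y)) => [cg|].
    rewrite mem_rcons inE => /orP[/eqP->|/tG]; rewrite mem_rcons inE ?eqxx //.
    by move=> ->; rewrite orbT.
  by rewrite big_rcons /= -ab mulrC subrK.
have [J0 JD JM] := ideal_gen_ideal (fun x => x \in s).
elim: t tG => [|[c g] t IHt] tG.
  by exists 0; rewrite big_nil mulr0 subr0.
have [cg ct|b tb] := IHt; first by apply: tG; rewrite inE ct orbT.
rewrite big_cons /=; have := tG _ (mem_head _ _).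
rewrite /= mem_rcons inE => /orP[/eqP->|gs].
  by exists (b + c); rewrite mulrDr opprD (mulrC y c) [X in X + (_ - _)]addrC addrACA subrr addr0.
exists b; rewrite -addrA; apply: JD => //; apply: JM.
by exists [:: (1, g)] => [cg|]; rewrite ?big_seq1 ?mul1r // inE => /eqP->.
Qed.

End IdealGen.

Section StanleyReisner.
Variables (K : fieldType) (n : nat) (D : scomplex n).
Local Notation S := {mpoly K[n]}.
Local Notation X := (fun i : 'I_n => 'X_i : S).
Local Notation I := (SR_ideal K D).
Local Notation R := (SR_ring K D).
Implicit Types (p q : S) (m : 'X_{1..n}) (A B : {set 'I_n}).

Definition supp m : {set 'I_n} := [set i | m i != 0%N].

Lemma SR_is_ideal : is_ideal I.
Proof. exact: ideal_gen_ideal. Qed.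

Lemma SR_coeff p m : I p -> supp m \in faces D -> p@_m = 0.
Proof.
case=> s sP -> mD; rewrite raddf_sum big_seq big1 // => -[c g] cgs /=.
have /= [A AD ->] := sP _ cgs.
have [i iA mi] : exists2 i, i \in A & m i = 0%N.
  have /subsetPn[i iA] : ~~ (A \subset supp m).
    by apply: contra AD => /faces_sub; apply.
  by rewrite inE negbK => /eqP; exists i.
by rewrite (bigD1 i) //= mulrCA mcoeffXM mi.
Qed.

Lemma SR_monomial m : supp m \notin faces D -> I 'X_[m].
Proof.
move=> mD; exists [:: (\prod_(i in supp m) 'X_i ^+ (m i).-1, \prod_(i in supp m) 'X_i)] => [cg|].
  by rewrite inE => /eqP->; exists (supp m).
rewrite big_seq1 /= -big_split /= mpolyXE_id (bigID (mem (supp m))) /=.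
rewrite [X in _ * X]big1 ?mulr1 => [|i]; last by rewrite inE negbK => /eqP->.
by apply: eq_bigr => i; rewrite inE => mi; rewrite -exprSr prednK ?lt0n.
Qed.

Definition SR_pi : S -> R := \pi_({ideal_quot SR_idealr K D})%qT.

HB.instance Definition _ := GRing.RMorphism.copy SR_pi
  (\pi_({ideal_quot SR_idealr K D})%qT : S -> {ideal_quot SR_idealr K D}).

Definition SR_repr (a : R) : S := repr (a : {ideal_quot SR_idealr K D}).

Lemma SR_reprK a : SR_pi (SR_repr a) = a.
Proof. exact: reprK. Qed.

Lemma SR_pi_eq0 p : SR_pi p = 0 <-> I p.
Proof.
rewrite -(rmorph0 SR_pi); split=> [/eqP|Ip].
  by rewrite -Quotient.idealrBE subr0 => /asboolP.
by apply/eqP; rewrite -Quotient.idealrBE subr0; apply/asboolP.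
Qed.

(** The prime generated by the variables in [B]. It is stated on a chosen representative; when the
    complement of [B] is a face, the ideal lies in the kernel of [mkill B] and the choice is
    immaterial. *)
Definition face_prime B (a : R) : Prop := mkill B (SR_repr a) = 0.

Lemma face_primeE B p : ~: B \in faces D -> face_prime B (SR_pi p) <-> mkill B p = 0.
Proof.
move=> BD; have kB q : I q -> mkill B q = 0.
  move=> Iq; apply/mkill_eq0P => m mB; apply: (SR_coeff Iq).
  apply: faces_sub BD; apply/subsetP => i; rewrite !inE; apply: contra => /mB ->.
  by [].
have : I (SR_repr (SR_pi p) - p).
  by apply/SR_pi_eq0; rewrite rmorphB /= SR_reprK subrr.
by move/kB/eqP; rewrite rmorphB subr_eq0 /= /face_prime => /eqP->.
Qed.

Lemma face_prime_prime B : ~: B \in faces D -> is_prime (face_prime B).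
Proof.
move=> BD; have E p := face_primeE p BD; split; first split.
- by rewrite -(rmorph0 SR_pi) E rmorph0.
- move=> a b; rewrite -(SR_reprK a) -(SR_reprK b) -rmorphD !E rmorphD /=.
  by move=> -> ->; rewrite addr0.
- move=> a b; rewrite -(SR_reprK a) -(SR_reprK b) -rmorphM !E rmorphM /=.
  by move=> ->; rewrite mulr0.
- by rewrite -(rmorph1 SR_pi) E rmorph1 => /eqP; rewrite oner_eq0.
move=> a b; rewrite -(SR_reprK a) -(SR_reprK b) -rmorphM !E rmorphM /=.
by move/eqP; rewrite mulf_eq0 => /orP[] /eqP; [left|right].
Qed.

Definition irrelevant : R -> Prop := face_prime setT.

Lemma irrelevantE p : irrelevant (SR_pi p) <-> p@_0%MM = 0.
Proof. by rewrite /irrelevant face_primeE ?mkillT_eq0 // setCT faces_empty. Qed.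

Lemma irrelevant_maximal : is_maximal irrelevant.
Proof.
have [mid m1 _] : is_prime irrelevant.
  by apply: face_prime_prime; rewrite setCT faces_empty.
split=> // J [J0 JD JM] mJ.
have [[a Ja am]|Jm] := pselect (exists2 a, J a & ~ irrelevant a); last first.
  by right => a Ja; apply: contrapT => am; apply: Jm; exists a.
left; pose p := SR_repr a; have p0 : p@_0%MM != 0.
  by apply/eqP => p0; apply: am; rewrite -(SR_reprK a); apply/irrelevantE.
pose c := (p@_0%MM)%:MP : S.
have Jc : J (SR_pi c).
  have -> : SR_pi c = a + SR_pi (c - p) by rewrite rmorphB /= SR_reprK addrC subrK.
  by apply: JD => //; apply/mJ/irrelevantE; rewrite mcoeffB mcoeffC eqxx mulr1 subrr.
have -> : 1 = SR_pi ((p@_0%MM)^-1%:MP) * SR_pi c.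
  by rewrite -rmorphM /= -mpolyCM mulVf // rmorph1.
exact: JM.
Qed.

(** The chain starts at the prime of the variables outside [A] and adds the variables of [A] one at
    a time. *)
Lemma irrelevant_dim A : A \in faces D -> local_dim_ge irrelevant #|A|.
Proof.
move=> AD; pose Fc i := ~: [set x in drop i (enum A)].
have FcD i : ~: Fc i \in faces D.
  rewrite setCK; apply: faces_sub AD; apply/subsetP => x; rewrite inE.
  by move/mem_drop; rewrite mem_enum.
exists (fun i => face_prime (Fc i)); split=> [i _|i iA|a].
- exact: face_prime_prime.
- have iE : (i < size (enum A))%N by rewrite -cardE.
  have [x0 _] : exists x0, x0 \in A by apply/card_gt0P; apply: leq_ltn_trans iA.
  have dE := drop_nth x0 iE; set x := nth x0 _ _ in dE.
  split.
    move=> a; rewrite -(SR_reprK a) !face_primeE //; apply: mkill_eq0_sub.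
    by rewrite setCS; apply/subsetP => y; rewrite !inE dE inE => ->; rewrite orbT.
  exists (SR_pi 'X_x); rewrite face_primeE // mkillXm.
    rewrite ifF //; apply/negbTE/forall_inPn; exists x; rewrite ?mnm1E ?eqxx //.
    have := enum_uniq A; rewrite -(cat_take_drop i (enum A)) cat_uniq dE.
    by rewrite !inE /= => /and3P[_ _ /andP[]].
  rewrite ifT; first by move/(congr1 (mcoeff U_(x)))/eqP; rewrite mcoeffX eqxx mcoeff0 oner_eq0.
  apply/forall_inP => y; rewrite !inE dE inE negb_or mnm1E eq_sym => /andP[/negPf->].
  by [].
rewrite -(SR_reprK a) face_primeE // irrelevantE -mkillT_eq0.
by apply: mkill_eq0_sub; apply: subsetT.
Qed.

(** Depth sensitivity: localised Koszul homology vanishes above degree n - d. The polynomial s is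
    the denominator coming from the localisation at the irrelevant ideal. *)
Lemma SR_koszul_vanishing d i (z : {set 'I_n} -> S^o) :
  local_depth_ge irrelevant d -> (n < i + d)%N ->
  ksupp i z -> (forall A, I (kd X z A)) ->
  exists2 s : S, s@_0%MM != 0 & exists2 u : {set 'I_n} -> S^o, ksupp i.+1 u &
    forall A, I (s * z A - kd X u A).
Proof.
move=> [xs [sz_xs xs_m xs_reg]] ni zi zI.
pose y k := SR_repr (nth 0 xs k).
pose L k (p : S^o) := ideal_gen (fun x => x \in take k xs) (SR_pi p).
have Lid k := ideal_gen_ideal (fun x => x \in take k xs).
have L0I p : L 0%N p <-> I p.
  rewrite /L take0; split=> [/ideal_gen_nil /SR_pi_eq0 //|/SR_pi_eq0 ->].
  by have [] := ideal_gen_ideal (fun x : R => x \in [::]).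
have [|||||||||||s Ts [u ui uz]] := @koszul_acyclic S n X S^o (fun s => s@_0%MM != 0) d y L
  _ _ _ _ _ _ _ _ 0%N i z _ _ zi.
- by rewrite mcoeff1 eqxx oner_eq0.
- by move=> s t s0 t0; rewrite rmorphM mulf_neq0.
- by move=> k; have [+ _ _] := Lid k; rewrite /L rmorph0.
- by move=> k v w Lv Lw; have [_ + _] := Lid k; rewrite /L rmorphD; apply.
- by move=> k c v Lv; have [_ _ +] := Lid k; rewrite /L rmorphM; apply.
- move=> k kd; apply: maximal_ideal_span; apply/irrelevantE.
  by rewrite SR_reprK; apply/xs_m/mem_nth; rewrite sz_xs.
- move=> k v kd; rewrite /L (take_nth 0) ?sz_xs // ideal_gen_rcons.
  split=> [[b vb]|[w wv]]; [exists (SR_repr b)|exists (SR_pi w)].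
    by rewrite rmorphB rmorphM /= !SR_reprK.
  by move: wv; rewrite rmorphB rmorphM /= SR_reprK.
- move=> k v kd Lv; have := xs_reg k kd (SR_pi v).
  case=> [|s sm sL].
    have [_ m1 _] := irrelevant_maximal; exists 1 => //.
    by rewrite mul1r; move: Lv; rewrite /L rmorphM /= SR_reprK.
  exists (SR_repr s); last by rewrite /L rmorphM /= SR_reprK.
  by apply/eqP => s0; apply: sm; rewrite -(SR_reprK s); apply/irrelevantE.
- by [].
- by rewrite addn0.
- by move=> A; apply/L0I.
- by exists s => //; exists u => // A; apply/L0I/uz.
Qed.

End StanleyReisner.

(** * Koszul classes and the 1-skeleton *)

Section KoszulClasses.
Variables (K : fieldType) (n : nat) (D : scomplex n).
Local Notation S := {mpoly K[n]}.
Local Notation X := (fun i : 'I_n => 'X_i : S).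
Local Notation I := (SR_ideal K D).
Implicit Types (p q : S) (m : 'X_{1..n}) (A B W : {set 'I_n}).

Definition adj (i j : 'I_n) := (i != j) && ([set i; j] \in faces D).

Lemma adj_sym i j : adj i j = adj j i.
Proof. by rewrite /adj eq_sym setUC. Qed.

Definition mset A : 'X_{1..n} := [multinom (i \in A : nat) | i < n].

Lemma supp_mset A : supp (mset A) = A.
Proof. by apply/setP => i; rewrite inE mnmE eqb0 negbK. Qed.

Lemma mdeg_mset A : mdeg (mset A) = #|A|.
Proof.
rewrite mdegE -sum1_card [RHS]big_mkcond; apply: eq_bigr => i _.
by rewrite mnmE; case: (i \in A).
Qed.

Lemma suppU1 (i : 'I_n) : supp U_(i)%MM = [set i].
Proof. by apply/setP => j; rewrite !inE mnm1E eqb0 negbK eq_sym. Qed.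

Lemma suppD m m' : supp (m + m')%MM = supp m :|: supp m'.
Proof. by apply/setP => j; rewrite !inE mnmDE addn_eq0 negb_and. Qed.

Lemma mcoeff_sign k p m : ((-1) ^+ k * p)@_m = (-1) ^+ k * p@_m.
Proof.
rewrite -[in LHS]signr_odd -[in RHS]signr_odd.
by case: odd; rewrite ?expr0 ?expr1 ?mul1r // !mulN1r mcoeffN.
Qed.

Lemma kd_scalarE (u : {set 'I_n} -> S^o) A m :
  (kd X u A)@_m = \sum_(j | j \notin A)
    (if (0 < m j)%N then (-1) ^+ pos j A * (u (j |: A))@_(m - U_(j))%MM else 0).
Proof.
rewrite raddf_sum; apply: eq_bigr => j _ /=.
rewrite -[_ *: _]/(_ * _) -mulrA mcoeff_sign mcoeffXM.
by case: ifP => // _; rewrite mulr0.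
Qed.

Lemma setD2D1 W i j : i \in W -> i != j -> i |: (W :\: [set i; j]) = W :\ j.
Proof.
move=> iW ij; apply/setP => k; rewrite !inE.
by case: (eqVneq k i) => [->|]; rewrite ?ij ?iW //= negb_or.
Qed.

Lemma pos_setD1 j A : pos j (A :\ j) = pos j A.
Proof.
have [jA|jA] := boolP (j \in A); first by rewrite [RHS](posD1 j jA) ltnn.
by congr pos; apply/setDidPl; rewrite disjoint_sym disjoints1.
Qed.

(** In multidegree [W], only e_W with a constant coefficient can map to x_w e_(W - w). *)
Lemma coeff_kdU1 (u : {set 'I_n} -> S^o) W w : w \in W ->
  (kd X u (W :\ w))@_U_(w)%MM = (-1) ^+ pos w W * (u W)@_0%MM.
Proof.
move=> wW; rewrite kd_scalarE (bigD1 w) ?setD11 //= mnm1E eqxx /=.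
rewrite setD1K // pos_setD1 (_ : (_ - _)%MM = 0%MM) ?big1 ?addr0 //.
  by move=> j /andP[_ jw]; rewrite mnm1E eq_sym (negPf jw).
by apply/mnmP => i; rewrite mnmBE subnn mnm0E.
Qed.

(** One Koszul degree lower, the multidegree [W] part of u is a function h on the vertices of [W],
    and its boundary at {i, j} is the simplicial coboundary of h. *)
Lemma coeff_kdU2 (u : {set 'I_n} -> S^o) W i j :
  let h w := (-1) ^+ pos w W * (u (W :\ w))@_U_(w)%MM in
  i \in W -> j \in W -> i != j ->
  exists k, (kd X u (W :\: [set i; j]))@_(U_(i) + U_(j))%MM = (-1) ^+ k * (h j - h i).
Proof.
move=> h iW jW ij; set A := W :\: _.
have iA : i \notin A by rewrite !inE eqxx.
have jA : j \notin A by rewrite !inE eqxx orbT.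
have Ai : i |: A = W :\ j by apply: setD2D1.
have Aj : j |: A = W :\ i by rewrite /A [[set i; j]]setUC; apply: setD2D1; rewrite 1?eq_sym.
exists (pos i A + pos j (i |: A))%N.
rewrite kd_scalarE (bigD1 i) //= (bigD1 j) ?jA 1?eq_sym //= big1 => [|k]; last first.
  move=> /andP[/andP[_ ki] kj]; rewrite mnmDE !mnm1E eq_sym (negPf ki).
  by rewrite eq_sym (negPf kj).
rewrite addr0 !mnmDE !mnm1E !eqxx (negPf ij) eq_sym (negPf ij) /= addmC addmK.
rewrite [in X in _ + X]addmC addmK mulrBr /h; congr (_ + _).
  by rewrite exprD -mulrA Ai pos_setD1 signrMK.
by rewrite pos_swap // mulNr opprK exprD -mulrA Aj pos_setD1 signrMK.
Qed.

(* For c constant on the connected components of W this is the class of c in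
   the multidegree W part of Koszul homology, which is the reduced cohomology
   H^0 of the restriction of D to W. *)
Definition zcomp W (c : 'I_n -> K) A : S :=
  \sum_(w in W) (if A == W :\ w then ((-1) ^+ pos w W * c w) *: 'X_w else 0).

Lemma zcomp_supp W c i : #|W| = i.+1 -> ksupp i (zcomp W c : _ -> S^o).
Proof.
move=> Wi A Ai; rewrite /zcomp big1 // => w wW; case: eqP => // AE.
by move: Ai Wi; rewrite AE (cardsD1 w W) wW; case: eqP => // H _ [].
Qed.

Lemma zcomp_homog W c A : zhomog (#|W|%:Z - #|A|%:Z) (zcomp W c A).
Proof.
apply: zhomog_sum => w wW; case: eqP => [->|_]; last exact: zhomog0.
rewrite -mul_mpolyC; apply: zhomogCM; rewrite (cardsD1 w W) wW.
have := zhomogX K (U_(w)%MM : 'X_{1..n}); rewrite mdeg1.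
by congr zhomog; lia.
Qed.

Lemma zcomp_eq0 W c A : (forall w, w \in W -> A != W :\ w) -> zcomp W c A = 0.
Proof. by move=> AW; rewrite /zcomp big1 // => w /AW/negPf->. Qed.

Lemma setD1_inj W i j : i \in W -> W :\ i = W :\ j -> i = j.
Proof. by move=> iW /setP/(_ i); rewrite !inE eqxx iW andbT; case: eqP. Qed.

Lemma zcompE W c w : w \in W ->
  zcomp W c (W :\ w) = ((-1) ^+ pos w W * c w) *: 'X_w.
Proof.
move=> wW; rewrite /zcomp (bigD1 w) //= eqxx big1 ?addr0 // => j /andP[jW jw].
by case: eqP => // /(setD1_inj wW) wj; rewrite wj eqxx in jw.
Qed.

Lemma coeff_zcomp W W' c w : w \in W ->
  (zcomp W' c (W :\ w))@_U_(w)%MM = if W' == W then (-1) ^+ pos w W * c w else 0.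
Proof.
move=> wW; case: eqP => [->|WW'].
  by rewrite zcompE // mcoeffZ mcoeffXU eqxx mulr1.
rewrite /zcomp raddf_sum big1 // => j jW' /=; case: eqP; rewrite ?mcoeff0 // => WE.
rewrite mcoeffZ mcoeffXU; case: eqP => jw; last by rewrite mulr0.
by case: WW'; rewrite -(setD1K jW') -WE jw setD1K.
Qed.

Lemma sign_scale k l c (i j : 'I_n) :
  ((-1) ^+ k * 'X_i) *: ((((-1) ^+ l * c) *: 'X_j : S) : S^o) =
  ((-1) ^+ (k + l) * c) *: ('X_i * 'X_j) :> S.
Proof.
rewrite -[LHS]/(_ * _) -scalerAr -mulrA exprD.
rewrite -[in LHS](signr_odd _ k) -[in RHS](signr_odd _ k).
by case: odd; rewrite ?expr0 ?expr1 ?mul1r // !mulN1r mulNr scalerN scaleNr.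
Qed.

(** The boundary lives on the sets W - {i, j}, where it is (c j - c i) x_i x_j up to sign: zero on
    an edge, in the ideal on a nonedge. *)
Lemma zcomp_cycle W c : (forall i j, i \in W -> j \in W -> adj i j -> c i = c j) ->
  forall A, I (kd X (zcomp W c : _ -> S^o) A).
Proof.
have [I0 ID IM] := SR_is_ideal K D.
move=> cadj A; have [/andP[AW /cards2P[i [j [ij WA]]]]|AW] :=
    boolP ((A \subset W) && (#|W :\: A| == 2)%N); last first.
  rewrite [kd _ _ _]big1 // => i iA; rewrite zcomp_eq0 ?scaler0 // => j jW.
  apply: contra AW => /eqP AE.
  have iW : i \in W by have := setU11 i A; rewrite AE !inE => /andP[].
  have ij : i != j by have := setU11 i A; rewrite AE !inE => /andP[].
  have -> : A = W :\: [set i; j].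
    apply/setP => k; rewrite !inE negb_or.
    have := congr1 (fun B => k \in B) AE; rewrite !inE /=.
    by case: (eqVneq k i) => [->|] //=; rewrite (negPf iA).
  rewrite subsetDl setDDr setDv set0U (setIidPr _) ?cards2 ?ij //.
  by apply/subsetP => k; rewrite !inE => /orP[] /eqP->.
have [iW jW] : i \in W /\ j \in W.
  by have := subsetDl W A; rewrite WA subUset !sub1set => /andP.
have AE : A = W :\: [set i; j] by rewrite -WA setDDr setDv set0U (setIidPr AW).
have iA : i \notin A by rewrite AE !inE eqxx.
have jA : j \notin A by rewrite AE !inE eqxx orbT.
have Ai : i |: A = W :\ j by rewrite AE; apply: setD2D1.
have Aj : j |: A = W :\ i by rewrite AE [[set i; j]]setUC; apply: setD2D1; rewrite 1?eq_sym.
have -> : kd X (zcomp W c : _ -> S^o) A =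
    ((-1) ^+ (pos i A + pos j (i |: A)) * (c j - c i)) *: ('X_i * 'X_j).
  rewrite /kd (bigD1 i) //= (bigD1 j) ?jA 1?eq_sym //= big1 ?addr0 => [|k]; last first.
    move=> /andP[/andP[kA ki] kj]; rewrite zcomp_eq0 ?scaler0 // => l lW.
    apply/eqP => AE'; have : k \in W :\: A.
      by rewrite inE kA; have := setU11 k A; rewrite AE' !inE => /andP[].
    by rewrite WA !inE (negPf ki) (negPf kj).
  rewrite Ai Aj !zcompE // !sign_scale -Ai [in X in _ + X](mulrC 'X_j).
  rewrite mulrBr scalerBl; congr (_ + _).
    by rewrite Ai -[pos j W]pos_setD1.
  by rewrite pos_swap // Aj mulNr scaleNr opprK pos_setD1.
have [ijD|ijD] := boolP ([set i; j] \in faces D).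
  by rewrite (cadj i j) ?subrr ?mulr0 ?scale0r // /adj ij.
rewrite -mul_mpolyC -mpolyXD; apply/IM/SR_monomial.
by rewrite suppD !suppU1.
Qed.

(** Without such an edge the indicator of [P] is a cycle of Koszul degree #|W| - 1 > n - d, hence a
    boundary up to s. *)
Lemma disconnected_bound d W (P : {set 'I_n}) :
  local_depth_ge (@irrelevant K n D) d -> (n.+1 < #|W| + d)%N ->
  P \subset W -> P != set0 -> P != W ->
  exists i j, [/\ i \in P, j \in W :\: P & adj i j].
Proof.
move=> depth_d Wd PW P0 PW'; apply: contrapT => noadj.
have [i0 i0P] := set0Pn _ P0.
have [j0 j0W j0P] : exists2 j, j \in W & j \notin P.
  apply/subsetPn; apply: contra PW' => WP; rewrite eqEsubset PW; exact: WP.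
have i0W : i0 \in W := subsetP PW _ i0P.
have WE : #|W| = #|W :\ i0|.+1 by rewrite (cardsD1 i0 W) i0W.
pose c (i : 'I_n) : K := (i \in P)%:R.
have [||s s0 [u _ uz]] := SR_koszul_vanishing depth_d _ (zcomp_supp c WE) _.
- by rewrite WE in Wd; lia.
- apply: zcomp_cycle => i j iW jW ij; congr (_%:R).
  have [iP|iP] := boolP (i \in P); have [jP|jP] := boolP (j \in P) => //.
    by case: noadj; exists i, j; rewrite !inE jP jW.
  by case: noadj; exists j, i; rewrite !inE iP iW adj_sym.
(* The right-hand side does not depend on w, so the indicator of [P] would be constant on [W]. *)
have key w : w \in W -> s@_0%MM * c w = (u W)@_0%MM.
  move=> wW; have : (s * zcomp W c (W :\ w) - kd X u (W :\ w))@_U_(w)%MM = 0.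
    by apply: (SR_coeff (uz _)); rewrite suppU1 faces_vertex.
  rewrite mcoeffB coeff_kdU1 // zcompE // -scalerAr mcoeffZ (mulrC s) mcoeffXM mnm1E eqxx.
  rewrite (_ : (_ - _)%MM = 0%MM); last by apply/mnmP => i; rewrite mnmBE subnn mnm0E.
  rewrite -mulrA -mulrBr => /eqP; rewrite mulf_eq0 signr_eq0 subr_eq0 => /eqP.
  by rewrite mulrC.
have := key i0 i0W; rewrite -(key j0 j0W) /c i0P (negPf j0P) mulr0 mulr1.
by move/eqP; rewrite (negPf s0).
Qed.

End KoszulClasses.

(** * Consequences of linearity for the complex *)

Section LinearClasses.
Variables (K : fieldType) (n : nat) (D : scomplex n) (F : gfree_resolution (SR_ideal K D)).
Local Notation S := {mpoly K[n]}.
Local Notation X := (fun i : 'I_n => 'X_i : S).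
Local Notation I := (SR_ideal K D).
Implicit Types (A B W : {set 'I_n}).

Lemma SR_koszul_to_tor p e N (z : 'I_N -> {set 'I_n} -> S^o) :
  (0 < p)%N -> (forall k, ksupp p (z k)) ->
  (forall k (A : {set 'I_n}), zhomog (e - #|A|%:Z) (z k A)) ->
  (forall k A, I (kd X (z k) A)) ->
  exists C : 'M[K]_(N, rk F p), [/\ (C <= tor_cycles F p)%MS,
    (C <= tor_strand F p e)%MS
  & forall a : 'rV[K]_N, (a *m C <= diffK F p)%MS ->
    exists2 u : {set 'I_n} -> S^o, ksupp p.+1 u &
      forall A, I (\sum_k a 0 k *: z k A - kd X u A)].
Proof.
move=> p0 zp ze zI; pose Z A : 'cV[S]_N := \col_k z k A.
have I_cst : forall q, I q -> q@_0%MM = 0 by apply: SR_ideal_coeff0.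
have kdZ (u : {set 'I_n} -> 'cV[S]_N) A b :
    kd X u A b 0 = kd X (fun B => u B b 0 : S^o) A.
  by rewrite kd_entry.
have [|A a b|A a|C [Cc Cs CE]] := @koszul_to_tor K n I F I_cst p N e Z p0.
- by move=> A Ap; apply/matrixP => a b; rewrite !mxE zp.
- by rewrite mxE subr0; apply: ze.
- rewrite kdZ; rewrite (_ : kd _ _ _ = kd X (z a) A) //.
  by apply: eq_kd => B; rewrite mxE.
exists C; split=> // a /CE[u up uE].
exists (fun A => u A 0 0) => [A Ap|A]; first by rewrite up // mxE.
have := uE A 0; rewrite !mxE; congr (I (_ - _)); last by rewrite kd_entry.
by apply: eq_bigr => k _; rewrite !mxE mul_mpolyC.
Qed.

Lemma linear_koszul p e (z : {set 'I_n} -> S^o) :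
  has_linear_resolution F 1 -> (0 < p)%N -> e <> p%:Z + 1 ->
  ksupp p z -> (forall A : {set 'I_n}, zhomog (e - #|A|%:Z) (z A)) ->
  (forall A, I (kd X z A)) ->
  exists2 u : {set 'I_n} -> S^o, ksupp p.+1 u & forall A, I (z A - kd X u A).
Proof.
move=> [_ Flin] p0 ep zp ze zI.
have [C [Cc Cs CE]] := SR_koszul_to_tor p0 (fun _ : 'I_1 => zp) (fun _ : 'I_1 => ze)
  (fun _ : 'I_1 => zI).
have [|u up uE] := CE 1%:M.
  rewrite mul1mx; have T0 : tor_gdim F p e = 0%N.
    rewrite (_ : e = p%:Z + (e - p%:Z)); last by rewrite addrC subrK.
    by apply: Flin => // e1; apply: ep; rewrite -[1]/(1%:Z) -e1 addrC subrK.
  by apply: submx_trans (tor_gdim_eq0 T0); rewrite sub_capmx Cc Cs.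
by exists u => // A; have := uE A; rewrite big_ord1 mxE eqxx scale1r.
Qed.

Lemma SR_sum (J : finType) (P : pred J) (G : J -> S) :
  (forall k, P k -> I (G k)) -> I (\sum_(k | P k) G k).
Proof.
have [I0 ID _] := SR_is_ideal K D.
by move=> GI; elim/big_rec: _ => // k x Pk Ix; apply: ID => //; apply: GI.
Qed.

(* When {i, j} is an edge of W lying in no triangle of W, its indicator is a
   1-cocycle of the restriction of D to W, of Tor degree #|W| in homological
   degree #|W| - 2; by linearity it is the coboundary of some h. *)
Lemma triangle_free_edge W (i j : 'I_n) :
  has_linear_resolution F 1 -> (2 < #|W|)%N -> i \in W -> j \in W -> adj D i j ->
  (forall k, k \in W -> k != i -> k != j -> ~~ (adj D i k && adj D j k)) ->
  exists2 h : 'I_n -> K, h i != h j &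
    forall k l, k \in W -> l \in W -> adj D k l -> [set k; l] != [set i; j] -> h k = h l.
Proof.
move=> Flin W2 iW jW /andP[ij ijD] no_tri.
have [I0 ID IM] := SR_is_ideal K D.
pose E := W :\: [set i; j].
have ijW : [set i; j] \subset W by rewrite subUset !sub1set iW.
have EW : (#|E| + 2 = #|W|)%N.
  by rewrite -(cardsID [set i; j] W) (setIidPr ijW) cards2 ij addnC.
pose z A : S^o := if A == E then 'X_i * 'X_j else 0.
have ijX : 'X_i * 'X_j = 'X_[U_(i) + U_(j)] :> S by rewrite mpolyXD.
have zE (A : {set 'I_n}) : #|A| != #|E| -> z A = 0.
  by rewrite /z; have [->|//] := eqVneq A E; rewrite eqxx.
have zh (A : {set 'I_n}) : zhomog (#|W|%:Z - #|A|%:Z) (z A).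
  rewrite /z; case: eqP => [->|_]; last exact: zhomog0.
  rewrite ijX; have := zhomogX K (U_(i) + U_(j))%MM.
  by rewrite mdegD !mdeg1; congr zhomog; lia.
have zI A : I (kd X z A).
  apply: SR_sum => k kA; rewrite /z; case: eqP => [AE|_]; last by rewrite scaler0.
  have : k \in E by rewrite -AE setU11.
  rewrite !inE negb_or => /andP[/andP[ki kj] kW].
  rewrite -[_ *: _]/(_ * _) -mulrA; apply: IM.
  rewrite ijX -mpolyXD; apply: SR_monomial; rewrite !suppD !suppU1.
  apply: contra (no_tri k kW ki kj) => kijD.
  have sub_face B : B \subset k |: [set i; j] -> B \in faces D.
    by move=> /faces_sub; apply.
  rewrite /adj !(eq_sym _ k) ki kj !sub_face //.
    by apply/subsetP => l; rewrite !inE => /orP[] /eqP->; rewrite eqxx ?orbT.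
  by apply/subsetP => l; rewrite !inE => /orP[] /eqP->; rewrite eqxx ?orbT.
have [||u _ uE] := linear_koszul Flin _ _ zE zh zI; [lia | lia |].
pose h w := (-1) ^+ pos w W * (u (W :\ w))@_U_(w)%MM.
have key k l : k \in W -> l \in W -> k != l -> [set k; l] \in faces D ->
    exists t, (z (W :\: [set k; l]))@_(U_(k) + U_(l))%MM = (-1) ^+ t * (h l - h k).
  move=> kW lW kl klD; have [t ut] := coeff_kdU2 u kW lW kl.
  exists t; rewrite -ut; apply/eqP; rewrite -subr_eq0 -mcoeffB; apply/eqP.
  by apply: (SR_coeff (uE _)); rewrite suppD !suppU1.
exists h.
  have [t] := key i j iW jW ij ijD; rewrite /z eqxx ijX mcoeffX eqxx.
  apply: contra_eq_neq => ->; rewrite subrr mulr0.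
  exact: oner_neq0.
move=> k l kW lW /andP[kl klD] klij; have [t] := key k l kW lW kl klD.
rewrite /z ifF ?mcoeff0 => [/esym/eqP|].
  by rewrite mulf_eq0 signr_eq0 subr_eq0 => /eqP.
have klW : [set k; l] \subset W by rewrite subUset !sub1set kW.
apply: contraNF klij => /eqP/(congr1 (setD W)).
by rewrite !setDDr !setDv !set0U (setIidPr klW) (setIidPr ijW) => ->.
Qed.

(* W is a minimal nonface: X^(W - w) e_w is a Koszul cycle, and a preimage up to
   the ideal would put X^W into the maximal ideal times I. *)
Lemma flag_step W : has_linear_resolution F 1 -> (2 < #|W|)%N ->
  (forall w, w \in W -> W :\ w \in faces D) -> W \in faces D.
Proof.
move=> Flin W2 Wface; apply: contrapT => /negP WD.
have [w wW] : exists w, w \in W by apply/card_gt0P; lia.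
pose z A : S^o := if A == [set w] then 'X_[mset (W :\ w)] else 0.
have zp (A : {set 'I_n}) : #|A| != 1%N -> z A = 0.
  by rewrite /z; have [->|//] := eqVneq A [set w]; rewrite cards1.
have zh (A : {set 'I_n}) : zhomog (#|W|%:Z - #|A|%:Z) (z A).
  rewrite /z; case: eqP => [->|_]; last exact: zhomog0.
  have := zhomogX K (mset (W :\ w)); rewrite mdeg_mset cards1 (cardsD1 w W) wW.
  by congr zhomog; lia.
have zd0 : kd X z set0 = 'X_[mset W].
  rewrite /kd (bigD1 w) ?inE //= big1 => [|j /andP[_ jw]].
    rewrite addr0 setU0 /z eqxx /pos (_ : [set k in _ | _] = set0) ?cards0.
      rewrite mul1r -[_ *: _]/(_ * _) -mpolyXD; congr 'X_[_].
      apply/mnmP => i; rewrite mnmDE mnm1E !mnmE !inE eq_sym.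
      by case: eqP => [->|]; rewrite ?wW.
    by apply/setP => k; rewrite !inE.
  by rewrite setU0 /z (inj_eq set1_inj) (negPf jw) scaler0.
have zI A : I (kd X z A).
  have [->|A0] := eqVneq A set0.
    by rewrite zd0; apply: SR_monomial; rewrite supp_mset.
  rewrite [kd _ _ _]big1 => [|j jA]; first by have [] := SR_is_ideal K D.
  rewrite zp ?scaler0 // cardsU1 jA; move: A0; rewrite -cards_eq0; lia.
have [||u _ uE] := linear_koszul Flin _ _ zp zh zI; [by [] | lia |].
have := congr1 (mcoeff (mset W)) zd0.
(* Subtracting [kd X (kd X u)], which is 0, turns the coefficient of X^W into a sum of coefficients
   of z - kd u at X^(W - j); each vanishes because W - j is a face. *)
rewrite -[kd X z set0]subr0 -(kdK X u set0) -kdB kd_scalarE mcoeffX eqxx big1.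
  by move/esym/eqP; rewrite oner_eq0.
move=> j _; rewrite mnmE; case: (boolP (j \in W)) => //= jW.
rewrite (_ : (_ - _)%MM = mset (W :\ j)); last first.
  apply/mnmP => i; rewrite mnmBE mnm1E !mnmE !inE eq_sym.
  by case: eqP => [->|]; rewrite ?jW ?subn0.
by rewrite (SR_coeff (uE _)) ?mulr0 // supp_mset; apply: Wface.
Qed.

Lemma clique_face W : has_linear_resolution F 1 ->
  {in W &, forall i j, i != j -> adj D i j} -> W \in faces D.
Proof.
move=> Flin; have [k] := ubnP #|W|; elim: k W => // k IHk W Wk Wadj.
case: (ltnP 2 #|W|) => [W2|].
  apply: flag_step => // w wW; apply: IHk.
    by move: Wk; rewrite (cardsD1 w) wW.
  by move=> i j /setD1P[_ iW] /setD1P[_ jW]; apply: Wadj.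
case W2: #|W| => [|[|[|//]]] _; first by rewrite (cards0_eq W2) faces_empty.
  by have /eqP/cards1P[w ->] := W2; apply: faces_vertex.
have /eqP/cards2P[i [j [ij WE]]] := W2.
have /andP[] : adj D i j by apply: Wadj => //; rewrite WE !inE eqxx ?orbT.
by rewrite WE.
Qed.

(* P k is a union of components of W k, so its indicator is a reduced 0-cocycle;
   the last hypothesis is linear independence modulo constants on each W k. *)
Lemma tor_gdim_components c N (W P : 'I_N -> {set 'I_n}) :
  (0 < c)%N -> (forall k, #|W k| = c.+1) ->
  (forall k i j, i \in W k -> j \in W k -> adj D i j -> (i \in P k) = (j \in P k)) ->
  (forall a : 'I_N -> K,
     (forall (U : {set 'I_n}) i j, i \in U -> j \in U ->
       \sum_(k | W k == U) a k * (i \in P k)%:R = \sum_(k | W k == U) a k * (j \in P k)%:R) ->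
     forall k, a k = 0) ->
  (N <= tor_gdim F c (c%:Z + 1))%N.
Proof.
move=> c0 Wc Padj indep; pose ind k (i : 'I_n) : K := (i \in P k)%:R.
pose z k A : S^o := zcomp (W k) (ind k) A.
have [|k A|k A|C [Cc Cs CE]] := @SR_koszul_to_tor c (c%:Z + 1) N z c0.
- by move=> k; apply: zcomp_supp (Wc k).
- have -> : c%:Z + 1 = #|W k|%:Z by rewrite Wc; lia.
  exact: zcomp_homog.
- by apply: zcomp_cycle => i j iW jW ij; rewrite /ind (Padj k i j iW jW ij).
apply: (tor_gdim_ge Cc Cs) => a /CE[u up uE]; apply/rowP => k; rewrite mxE.
apply: indep k => U i j iU jU.
suff key w : w \in U -> \sum_(k | W k == U) a 0 k * (w \in P k)%:R = (u U)@_0%MM.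
  by rewrite !key.
move=> wU; have : (\sum_k a 0 k *: z k (U :\ w) - kd X u (U :\ w))@_U_(w)%MM = 0.
  by apply: (SR_coeff (uE _)); rewrite suppU1 faces_vertex.
rewrite mcoeffB coeff_kdU1 // raddf_sum /=.
rewrite (eq_bigr (fun k => (-1) ^+ pos w U * (if W k == U then a 0 k * ind k w else 0))).
  rewrite -mulr_sumr -mulrBr => /eqP; rewrite mulf_eq0 signr_eq0 subr_eq0 => /eqP <-.
  by rewrite -big_mkcond.
move=> k _; rewrite mcoeffZ /z coeff_zcomp //.
by case: ifP => _; rewrite ?mulr0 // mulrCA.
Qed.

End LinearClasses.

(** * Elimination of simplicial vertices *)

Section Elimination.
Variables (T : finType) (e : rel T).
Hypotheses (e_sym : ssrbool.symmetric e) (e_irr : irreflexive e).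
Implicit Types (W C U Z P : {set T}) (i j w x y : T).

Definition clique C := forall x y, x \in C -> y \in C -> x != y -> e x y.

(* No edge that lies in no triangle of W belongs to a cycle of W: the form in
   which chordality is provided by a linear resolution. *)
Hypothesis chordal : forall W i j, i \in W -> j \in W -> e i j -> (2 < #|W|)%N ->
  (forall k, k \in W -> ~~ (e i k && e j k)) ->
  exists2 h : T -> bool, h i != h j &
    forall k l, k \in W -> l \in W -> e k l -> [set k; l] != [set i; j] -> h k = h l.

Definition nbr U w := [set x in U | e w x].

Lemma clique_sub C C' : C' \subset C -> clique C -> clique C'.
Proof. by move=> /subsetP sub cC x y /sub xC /sub; apply: cC. Qed.

(* The set B is a component of W minus the closed neighbourhood of a, and Z is
   its boundary. *)
Lemma clique_separator W a b : a \in W -> b \in W -> a != b -> ~~ e a b ->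
  exists B Z : {set T}, [/\ B \subset W, Z \subset W :\: B, clique Z,
    [&& a \notin B, a \notin Z & b \in B] & forall x y, x \in W :\: B -> y \in B -> e x y -> x \in Z].
Proof.
move=> aW bW ab nab.
have [U inU] : exists U : {set T}, forall x, (x \in U) = [&& x \in W, x != a & ~~ e a x].
  by exists [set x in W | (x != a) && ~~ e a x] => x; rewrite inE.
have bU : b \in U by rewrite inU bW eq_sym ab.
pose r x y := [&& e x y, x \in U & y \in U].
have [B inB] : exists B : {set T}, forall x, (x \in B) = (x \in W) && connect r b x.
  by exists [set x in W | connect r b x] => x; rewrite inE.
have BU : B \subset U.
  apply/subsetP => x; rewrite inB => /andP[_].
  have rU : closed r (mem U) by move=> u v /and3P[_ /= -> ->].
  by move=> /(closed_connect rU) /= <-.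
have stepB x y : y \in B -> x \in U -> e x y -> x \in B.
  move=> yB xU xy; have := xU; rewrite !inB inU => /andP[-> _].
  have := yB; rewrite inB => /andP[_ /connect_trans] /=; apply; apply: connect1.
  by rewrite /r e_sym xy xU (subsetP BU).
have nBa u : u \in B -> (u != a) && ~~ e a u.
  by move=> /(subsetP BU); rewrite inU => /andP[].
have [Z inZ] : exists Z : {set T}, forall x,
    (x \in Z) = [&& x \in W, x \notin B & [exists y in B, e x y]].
  by exists [set x in W | (x \notin B) && [exists y in B, e x y]] => x; rewrite inE.
have Za x : x \in Z -> e a x.
  rewrite inZ => /and3P[xW xB /exists_inP[y yB xy]].
  have /andP[_ nay] := nBa y yB.
  have [xa|xa] := eqVneq x a; first by rewrite -xa xy in nay.
  apply: contraR xB => nax; apply: (stepB x y) => //.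
  by rewrite inU xW xa.
have aB : a \notin B by apply/negP => /nBa; rewrite eqxx.
have bB : b \in B by rewrite inB bW connect0.
exists B, Z; split=> [||||x y /setDP[xW xB] yB xy].
- by apply/subsetP => x; rewrite inB => /andP[].
- by apply/subsetP => x; rewrite inZ inE => /and3P[-> -> _].
- move=> x y xZ yZ xy; apply: contraT => nxy.
  have [ax ay] := (Za x xZ, Za y yZ).
  have xB : x \notin B by move: xZ; rewrite inZ => /and3P[].
  have neq_e u v : e u v -> u != v by apply: contraTneq => ->; rewrite e_irr.
  (* If x and y were not adjacent, the edge xa would lie in no triangle of W'. But h is constant
     along the way from x through B and y to a, so it cannot separate x from a. *)
  have [W' inW'] : exists W' : {set T}, forall u, (u \in W') = [|| u == a, u == x, u == y | u \in B].
    by exists (a |: (x |: (y |: B))) => u; rewrite !inE.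
  have [aW' xW' yW'] : [/\ a \in W', x \in W' & y \in W'].
    by rewrite !inW' !eqxx !orbT.
  have BW' u : u \in B -> u \in W' by rewrite inW' => ->; rewrite !orbT.
  have W'3 : (2 < #|W'|)%N.
    have sub : [set a; x; y] \subset W' by rewrite !subUset !sub1set aW' xW'.
    apply: leq_trans (subset_leq_card sub); rewrite -setUA cardsU1 cards2 !inE.
    by rewrite negb_or neq_e // neq_e // xy.
  have exa : e x a by rewrite e_sym.
  have [k|h hxa hE] := chordal xW' aW' exa W'3.
    rewrite inW' => /or4P[/eqP->|/eqP->|/eqP->|/nBa/andP[_ /negPf->]].
    - by rewrite e_irr andbF.
    - by rewrite e_irr.
    - by rewrite (negPf nxy).
    - by rewrite andbF.
  have hE' u v : u \in W' -> v \in W' -> e u v -> (u \notin [set x; a]) || (v \notin [set x; a]) ->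
      h u = h v.
    move=> uW vW uv uvxa; apply: hE => //; apply: contraL uvxa => /eqP <-.
    by rewrite !inE !eqxx orbT.
  have nxaB u : u \in B -> u \notin [set x; a].
    move=> uB; rewrite !inE negb_or; case/andP: (nBa u uB) => -> _.
    by rewrite andbT; apply: contraNneq xB => <-.
  have hB u : u \in B -> h u = h b.
    pose A := [pred z | (z \in B) && (h z == h b)].
    have Acl : closed r A.
      move=> p q /and3P[pq pU qU]; rewrite !inE; have [pB|pB] := boolP (p \in B).
        have qB : q \in B by apply: stepB pB qU _; rewrite e_sym.
        by rewrite qB (hE' p q) ?BW' // nxaB.
      suff /negPf-> : q \notin B by [].
      by apply: contra pB => qB; apply: stepB qB pU pq.
    move=> uB; have : connect r b u by move: uB; rewrite inB => /andP[].
    by move/(closed_connect Acl); rewrite !inE bB eqxx uB => /esym/eqP.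
  have hZ v : v \in Z -> v \in W' -> h v = h b.
    rewrite inZ => /and3P[_ vB /exists_inP[u uB vu]] vW'; rewrite -(hB u uB).
    by apply: hE' vW' (BW' u uB) vu _; rewrite (nxaB u uB) orbT.
  case/eqP: hxa; rewrite (hZ x) // -(hZ y) //; apply: hE' => //; first by rewrite e_sym.
  by rewrite !inE negb_or [y == x]eq_sym xy eq_sym neq_e.
- by rewrite aB bB andbT; apply/negP => /Za; rewrite e_irr.
- by rewrite inZ xW xB; apply/exists_inP; exists y.
Qed.

(** Dirac's lemma, strengthened by a clique to avoid so that the induction closes. The clique cannot
    meet both sides of the separator Z; the recursion goes to a side that it misses, with Z as the
    new clique to avoid. A vertex found there off Z has all its neighbours on that side or in Z, so
    it is simplicial in W. *)
Lemma exists_simplicial W C : C \proper W -> clique C ->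
  exists2 w, w \in W :\: C & clique (nbr W w).
Proof.
have [k] := ubnP #|W|; elim: k W C => // k IHk W C Wk CW cC.
have [cW|] := pselect (clique W).
  have /properP[_ [w wW wC]] := CW; exists w; first by rewrite inE wC.
  by apply: clique_sub cW; apply/subsetP => x; rewrite inE => /andP[].
move=> ncW; have [a [b [aW bW ab nab]]] : exists a b, [/\ a \in W, b \in W, a != b & ~~ e a b].
  apply: contrapT => no; apply: ncW => a b aW bW ab; apply: contraT => nab.
  by case: no; exists a, b.
have [B [Z [BW ZWB cZ /and3P[aB aZ bB] ZP]]] := clique_separator aW bW ab nab.
have ZW : Z \subset W by apply: subset_trans ZWB (subsetDl _ _).
have bZ : b \notin Z.
  by apply/negP => /(subsetP ZWB); rewrite inE bB.
have [BC0|] := eqVneq (C :&: B) set0; last first.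
  move=> /set0Pn[c /setIP[cC' cB]].
  have [|||w] := IHk (W :\: B) Z.
  - apply: leq_trans (_ : #|W| <= k)%N => //; rewrite -(cardsID B W) (setIidPr BW).
    by rewrite -[X in (X < _)%N]add0n ltn_add2r; apply/card_gt0P; exists b.
  - by apply/properP; split=> //; exists a; rewrite ?inE ?aB.
  - exact: cZ.
  rewrite inE => /andP[wZ wWB] cN; have /setDP[wW wB] := wWB.
  exists w.
    rewrite inE wW andbT; apply/negP => wC; case/negP: wZ.
    apply: (ZP w c) => //; apply: cC => //.
    by apply: contraNneq wB => ->.
  apply: clique_sub cN; apply/subsetP => x; rewrite !inE => /andP[xW wx].
  rewrite xW wx !andbT; apply: contra wZ => xB; exact: (ZP w x).
have [|||w] := IHk (B :|: Z) Z.
- apply: leq_trans (_ : #|W| <= k)%N => //; apply: proper_card; apply/properP.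
  split; first by rewrite subUset BW ZW.
  by exists a; rewrite // inE negb_or aB.
- by apply/properP; split; [apply: subsetUr | exists b; rewrite ?inE ?bB].
- exact: cZ.
rewrite !inE => /andP[wZ]; rewrite (negPf wZ) orbF => wB cN.
exists w.
  rewrite inE (subsetP BW) // andbT; apply/negP => wC.
  by have := in_set0 w; rewrite -BC0 inE wC wB.
apply: clique_sub cN; apply/subsetP => x; rewrite !inE => /andP[xW wx].
rewrite wx andbT; have [//|xB /=] := boolP (x \in B).
by apply: (ZP x w) => //; rewrite ?inE ?xB // e_sym.
Qed.

Variable d : nat.
Hypothesis clique_le : forall C, clique C -> (#|C| <= d)%N.
Hypothesis connectivity : forall W P, (#|T|.+1 < #|W| + d)%N ->
  P \subset W -> P != set0 -> P != W ->
  exists i j, [/\ i \in P, j \in W :\: P & e i j].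

Definition closed_in W P := forall i j, i \in P -> j \in W -> e i j -> j \in P.

Definition universal U := [set v in U | [forall u in U, (u != v) ==> e v u]].

(** Eliminated vertices never connect what is disconnected in U - Z: every union of components of U
    - Z is the trace of one in the complement of Z in the whole graph. *)
Definition extendable U := forall Z P, P \subset U :\: Z -> closed_in (U :\: Z) P ->
  exists P', [/\ P' \subset ~: Z, closed_in (~: Z) P' & P' :&: U = P].

Lemma nbr_clique U w : w \in U -> clique (nbr U w) -> clique (w |: nbr U w).
Proof.
move=> wU cN x y; rewrite !in_setU1 => /predU1P[->|xN] /predU1P[->|yN] xy.
- by rewrite eqxx in xy.
- by move: yN; rewrite inE => /andP[].
- by rewrite e_sym; move: xN; rewrite inE => /andP[].
- exact: cN.
Qed.

(* Otherwise the component of w in the complement of nbr U w would be separated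
   from the rest of U by fewer than d - 1 vertices. *)
Lemma simplicial_degree U w : extendable U -> w \in U -> clique (nbr U w) ->
  w |: nbr U w != U ->
  (#|nbr U w|.+1 = d) /\ exists P, [/\ P \subset ~: nbr U w,
    closed_in (~: nbr U w) P & P :&: U = [set w]].
Proof.
move=> extU wU cN NU; set Z := nbr U w in cN NU *.
have wZ : w \notin Z by rewrite inE e_irr andbF.
have ZU : Z \subset U by apply/subsetP => x; rewrite inE => /andP[].
have [||P [PZ Pcl PU]] := extU Z [set w].
- by rewrite sub1set inE wZ.
- move=> i j; rewrite inE => /eqP-> /setDP[jU jZ] wj.
  by case/negP: jZ; rewrite inE jU.
split; last by exists P.
have := clique_le (nbr_clique wU cN); rewrite cardsU1 wZ add1n => Zd.
apply/eqP; rewrite eqn_leq Zd /= leqNgt; apply/negP => Zd'.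
have wP : w \in P by have := set11 w; rewrite -PU inE => /andP[].
have [|||i [j [iP /setDP[jZ jP] ij]]] := @connectivity (~: Z) P _ PZ.
- by have := cardsC Z; move: Zd'; lia.
- by apply/set0Pn; exists w.
- apply: contra NU => /eqP PE; rewrite eqEsubset subUset sub1set wU ZU /=.
  apply/subsetP => x xU; rewrite in_setU1 orbC; have [//|xZ /=] := boolP (x \in Z).
  by rewrite -in_set1 -PU inE xU PE inE xZ.
by case/negP: jP; apply: Pcl iP jZ ij.
Qed.

Variable K : fieldType.

(* The eliminated vertices w carry sets P w, closed in the complement of the
   separators Z w, whose indicators are independent. *)
Definition elimination U (Z P : T -> {set T}) := [/\
  forall w, w \notin U -> [/\ (#|Z w|.+1 = d)%N, P w :&: U = set0 & closed_in (~: Z w) (P w)],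
  forall a : T -> K, (forall (Y : {set T}) x, x \notin Y ->
      \sum_(w | (w \notin U) && (Z w == Y)) a w * (x \in P w)%:R = 0) ->
    forall w, w \notin U -> a w = 0,
  extendable U
& (#|universal U| <= #|universal setT| + (#|T| - #|U|))%N].

Lemma elimination_start : exists Z P : T -> {set T}, elimination setT Z P.
Proof.
exists (fun=> set0), (fun=> set0); split=> [w|a _ w|Y P PY Pcl|].
- by rewrite inE.
- by rewrite inE.
- exists P; rewrite -setTD; split=> //; exact: setIT.
- by rewrite leq_addr.
Qed.

Lemma elimination_step U (Z P : T -> {set T}) : elimination U Z P -> (d < #|U|)%N ->
  exists w (Z' P' : T -> {set T}), w \in U /\ elimination (U :\ w) Z' P'.
Proof.
move=> [ZP indep extU univU] dU.
have [||w] := @exists_simplicial U set0.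
- by rewrite proper0; apply/set0Pn/card_gt0P; lia.
- by move=> x y; rewrite inE.
rewrite setD0 => wU cN; set Y := nbr U w in cN.
have wY : w \notin Y by rewrite inE e_irr andbF.
have YU : Y \subset U by apply/subsetP => x; rewrite inE => /andP[].
have YwU : w |: Y != U.
  apply/eqP => YE; have := clique_le (nbr_clique wU cN).
  by rewrite YE leqNgt dU.
have [Yd [Q [QY Qcl QU]]] := simplicial_degree extU wU cN YwU; rewrite -/Y in Yd QY Qcl.
have wQ : w \in Q by have := set11 w; rewrite -QU inE => /andP[].
exists w, (fun v => if v == w then Y else Z v), (fun v => if v == w then Q else P v).
split=> //; split.
- move=> v; rewrite !inE negb_and negbK; case: (eqVneq v w) => [->|vw] /= vU.
    split=> //; apply/setP => x; have := congr1 (fun A : {set T} => x \in A) QU; rewrite !inE /=.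
    by case: eqP => // _; rewrite andbF.
  have [Zv PU Pcl] := ZP v vU; split=> //.
  by apply/eqP; rewrite -subset0 -PU setIS // subsetDl.
(* Independence is triangular: w lies in Q but in none of the earlier sets, which avoid U. *)
- move=> a aE; have aw0 : a w = 0.
    have := aE Y w wY; rewrite (bigD1 w) ?setD11 ?eqxx //= wQ mulr1 big1 ?addr0 //.
    move=> v /andP[/andP[vU _] vw]; rewrite (negPf vw).
    have [|_ PU _] := ZP v; first by move: vU; rewrite !inE vw.
    rewrite (_ : (w \in P v) = false) ?mulr0 //; apply/negP => wP.
    by have := in_set0 w; rewrite -PU inE wP wU.
  have aU : forall v, v \notin U -> a v = 0.
    apply: indep => X x xX; rewrite -[RHS](aE X x xX) big_mkcond [RHS]big_mkcond.
    apply: eq_bigr => v _; rewrite !inE; case: (eqVneq v w) => [->|vw] //=.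
    by rewrite wU aw0 !mul0r /= ?if_same.
  by move=> v; rewrite !inE negb_and negbK => /orP[/eqP->|/aU].
- move=> X R RX Rcl; have wR : w \notin R.
    by apply/negP => /(subsetP RX); rewrite !inE eqxx andbF.
  have sub_setI A B : A :&: U = B -> w \notin R -> B :\ w = R -> A :&: (U :\ w) = R.
    by move=> AB _ <-; rewrite -AB setIDA.
  have RD : R :\ w = R by apply/setDidPl; rewrite disjoint_sym disjoints1.
  have [wX|wX] := boolP (w \in X).
    have UX : U :\ w :\: X = U :\: X.
      by apply/setP => x; rewrite !inE; case: (eqVneq x w) => [->|]; rewrite ?wX.
    rewrite UX in RX Rcl; have [R' [R'X R'cl R'U]] := extU X R RX Rcl.
    by exists R'; split=> //; apply: sub_setI R'U _ _.
  have RU x : x \in R -> [/\ x \in U, x \notin X & x != w].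
    by move=> /(subsetP RX); rewrite !inE => /and3P[].
  (* The vertex w joins R exactly when it has a neighbour there. Its neighbours form a clique, so
     those outside X then all lie in R, and closedness is kept. *)
  have [[x xR wx]|noR] := pselect (exists2 x, x \in R & e w x); last first.
    have [||R' [R'X R'cl R'U]] := extU X R.
    - by apply: subset_trans RX (setSD _ _); apply: subsetDl.
    - move=> i j iR /setDP[jU jX] ij; apply: (Rcl i j) => //.
      rewrite !inE jX jU andbT; apply/eqP => jw; apply: noR.
      by exists i; rewrite // e_sym -jw.
    by exists R'; split=> //; apply: sub_setI R'U _ _.
  have [||R' [R'X R'cl R'U]] := extU X (w |: R).
  - rewrite subUset sub1set inE wX wU /=.
    by apply: subset_trans RX (setSD _ _); apply: subsetDl.
  - move=> i j iR /setDP[jU jX] ij; rewrite in_setU1; case: eqVneq => //= jw.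
    have jUX : j \in U :\ w :\: X by rewrite !inE jX jU jw.
    move: iR; rewrite in_setU1 => /predU1P[iw|iR]; last exact: Rcl ij.
    have [->//|jx] := eqVneq j x; have [xU _ _] := RU x xR.
    by apply: (Rcl x j) => //; apply: cN; rewrite ?inE 1?eq_sym ?xU ?jU -?iw // iw.
  by exists R'; split=> //; apply: sub_setI R'U _ _; rewrite // setU1K.
(* A universal vertex of U - w is universal in U if it is adjacent to w. The others extend the
   clique Y, which has d - 1 elements, within a clique of at most d; so at most one is new. *)
- have uY : universal (U :\ w) :&: Y \subset universal U.
    apply/subsetP => v; rewrite !inE -!andbA => /and5P[vw vU /forall_inP vE _ wv].
    rewrite vU; apply/forall_inP => u uU; apply/implyP => uv.
    have [->|uw] := eqVneq u w; first by rewrite e_sym.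
    have uU' : u \in U :\ w by rewrite !inE uw.
    by have /implyP := vE u uU'; apply.
  have cUY : clique (Y :|: universal (U :\ w)).
    have uE v u : v \in universal (U :\ w) -> u \in U :\ w -> u != v -> e v u.
      by rewrite inE => /andP[_ /forall_inP vE] /vE /implyP.
    have YUw x : x \in Y -> x \in U :\ w.
      by move=> xY; rewrite !inE (subsetP YU) // andbT; apply: contraTneq xY => ->.
    have uUw x : x \in universal (U :\ w) -> x \in U :\ w by rewrite inE => /andP[].
    move=> x y; rewrite !in_setU => /orP[xY|xU] /orP[yY|yU] xy; first exact: cN.
    - by rewrite e_sym; apply: uE => //; apply: YUw.
    - by apply: uE; rewrite 1?eq_sym //; apply: YUw.
    - by apply: uE; rewrite 1?eq_sym //; apply: uUw.
  have := clique_le cUY; have := subset_leq_card uY.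
  rewrite cardsU -(cardsID Y (universal (U :\ w))) [Y :&: _]setIC.
  have : (#|U| <= #|T|)%N by apply: max_card.
  have := subset_leq_card (subsetIl (universal (U :\ w)) Y).
  have := subset_leq_card (subsetIr (universal (U :\ w)) Y).
  move: univU Yd; rewrite (cardsD1 w U) wU -(cardsID Y (universal (U :\ w))); lia.
Qed.

Lemma eliminate : (0 < d <= #|T|)%N -> universal setT = set0 ->
  exists U (Z P : T -> {set T}), [/\ elimination U Z P, #|U| = d & (d <= #|~: U|)%N].
Proof.
move=> /andP[d0 dT] univT.
have [U [Z [P [UE Ud]]]] : exists U (Z P : T -> {set T}), elimination U Z P /\ #|U| = d.
  suff : forall k, (k <= #|T| - d)%N ->
      exists U (Z P : T -> {set T}), elimination U Z P /\ (#|U| = #|T| - k)%N.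
    by move=> /(_ _ (leqnn _)); rewrite subKn.
  elim=> [|k IHk] kT.
    by have [Z [P ?]] := elimination_start; exists setT, Z, P; rewrite cardsT subn0.
  have [|U [Z [P [UE Uk]]]] := IHk; first by apply: ltnW.
  have [|w [Z' [P' [wU UE']]]] := elimination_step UE; first by lia.
  by exists (U :\ w), Z', P'; split=> //; move: Uk; rewrite (cardsD1 w) wU; lia.
exists U, Z, P; split=> //; have [_ _ extU univU] := UE.
(* U must be a clique: a simplicial vertex whose closed neighbourhood is not all of U would have d -
   1 neighbours, and its closed neighbourhood would already fill the d elements of U. *)
suff uU : universal U = U.
  by move: univU; rewrite uU univT cards0 Ud add0n -(cardsC U) Ud addKn.
have [||w] := @exists_simplicial U set0.
- by rewrite proper0; apply/set0Pn/card_gt0P; rewrite Ud.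
- by move=> x y; rewrite inE.
rewrite setD0 => wU cN; have := nbr_clique wU cN.
have [YE|YE cY] := eqVneq (w |: nbr U w) U.
  rewrite YE => cU; apply/setP => v; rewrite inE; case: (boolP (v \in U)) => //= vU.
  by apply/forall_inP => u uU; apply/implyP => uv; apply: cU; rewrite 1?eq_sym.
have [Yd _] := simplicial_degree extU wU cN YE.
case/eqP: YE; apply/eqP; rewrite eqEcard cardsU1 inE e_irr andbF Ud -Yd leqnn andbT.
by rewrite subUset sub1set wU; apply/subsetP => x; rewrite inE => /andP[].
Qed.

End Elimination.

(** * The lower bound on the type under linearity *)

Section LinearType.
Variables (K : fieldType) (n d : nat) (D : scomplex n) (F : gfree_resolution (SR_ideal K D)).
Hypothesis face_le : forall A, A \in faces D -> (#|A| <= d)%N.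
Hypothesis depth_d : local_depth_ge (@irrelevant K n D) d.
Hypothesis Flin : has_linear_resolution F 1.
Local Notation e := (adj D).

Lemma adj_irr : irreflexive e.
Proof. by move=> i; rewrite /adj eqxx. Qed.

Lemma adj_chordal (W : {set 'I_n}) i j : i \in W -> j \in W -> e i j -> (2 < #|W|)%N ->
  (forall k, k \in W -> ~~ (e i k && e j k)) ->
  exists2 h : 'I_n -> bool, h i != h j &
    forall k l, k \in W -> l \in W -> e k l -> [set k; l] != [set i; j] -> h k = h l.
Proof.
move=> iW jW ij W2 no_tri.
have [k kW _ _|h hij hE] := triangle_free_edge Flin W2 iW jW ij; first exact: no_tri.
exists (fun k => h k == h i); first by rewrite eqxx (eq_sym (h j)) (negPf hij).
by move=> k l kW lW kl kl_ij; rewrite (hE k l).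
Qed.

(** In a clique complex a vertex adjacent to all others is a cone point, and cone points lie outside
    the core. *)
Lemma universal0 : faces D = core D -> universal e setT = set0.
Proof.
move=> Dcore; apply/setP => v; rewrite in_set0 inE in_setT /=; apply/negP => /forall_inP vE.
have := faces_vertex D v; rewrite Dcore inE sub1set inE => /andP[_].
rewrite eqEsubset negb_and => /orP[]; case/subsetPn => A.
  by rewrite inE => /andP[->].
move=> AD; rewrite inE AD /= => /negP; apply; apply: (clique_face Flin).
have vA x : x != v -> e v x by move=> xv; have /implyP := vE x (in_setT x); apply.
move=> x y; rewrite !in_setU !in_set1 => /orP[/eqP->|xA] /orP[/eqP->|yA] xy.
- by rewrite eqxx in xy.
- by apply: vA; rewrite eq_sym.
- by rewrite adj_sym; apply: vA.
rewrite /adj xy; apply: faces_sub AD.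
by rewrite subUset !sub1set xA.
Qed.

Lemma linear_tor_bound : (0 < d <= n)%N -> faces D = core D ->
  (d <= tor_gdim F (n - d) ((n - d)%N%:Z + 1))%N.
Proof.
move=> dn Dcore; have /andP[d_gt0 d_le] := dn; have card_n : #|'I_n| = n := card_ord n.
have clique_le (C : {set 'I_n}) : clique e C -> (#|C| <= d)%N.
  by move=> cC; apply/face_le/(clique_face Flin) => i j iC jC; apply: cC.
have conn (W P : {set 'I_n}) : (#|'I_n|.+1 < #|W| + d)%N ->
    P \subset W -> P != set0 -> P != W -> exists i j, [/\ i \in P, j \in W :\: P & e i j].
  by rewrite card_n; apply: (disconnected_bound depth_d).
have dn' : (0 < d <= #|'I_n|)%N by rewrite card_n.
have [U [Z [P [[ZP indep _ _] Ud dU]]]] := @eliminate _ e (adj_sym D) adj_irr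
  adj_chordal d clique_le conn K dn' (universal0 Dcore).
have UC : #|~: U| = (n - d)%N by have := cardsC U; rewrite Ud card_n; lia.
apply: (leq_trans dU); pose v (k : 'I_#|~: U|) : 'I_n := enum_val k.
have vU k : v k \notin U by have := enum_valP k; rewrite inE.
apply: (@tor_gdim_components _ _ _ _ _ _ (fun k => ~: Z (v k)) (P \o v)).
- by rewrite -UC; apply: leq_trans d_gt0 dU.
- move=> k; have [Zd _ _] := ZP _ (vU k).
  have /= := cardsC (Z (v k)); rewrite card_n => Zn.
  by rewrite -[LHS](addKn #|Z (v k)|) Zn -Zd; move: d_le; rewrite -Zd => /subnSK ->.
- move=> k i j iZ jZ ij; have [_ _ Pcl] := ZP _ (vU k).
  by apply/idP/idP => /Pcl; apply; rewrite // adj_sym.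
move=> a aE; pose a' w := \sum_(k | v k == w) a k.
have a'v k : a' (v k) = a k.
  rewrite /a' (big_pred1 k) // => l; exact: (inj_eq enum_val_inj).
suff a'0 w : w \notin U -> a' w = 0 by move=> k; rewrite -a'v a'0.
apply: indep => Y x xY; have sumE y : \sum_(w | (w \notin U) && (Z w == Y)) a' w * (y \in P w)%:R =
    \sum_(k | ~: Z (v k) == ~: Y) a k * (y \in P (v k))%:R.
  rewrite (eq_bigl (fun w => (w \in ~: U) && (Z w == Y))); last by move=> u; rewrite inE.
  rewrite big_enum_val_cond /=; apply: eq_big => k; first by rewrite (inj_eq (can_inj setCK)).
  by rewrite -/(v k) a'v.
have [u /andP[uU /eqP uY]|noY] := pickP (fun w => (w \notin U) && (Z w == Y)); last by rewrite big_pred0.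
have [Yd _ _] := ZP u uU; rewrite uY in Yd.
(* Relations hold only modulo constants on the complement of Y. As U has d elements and Y has d - 1,
   some y in U avoids Y; every P w misses U, so the constant is 0. *)
have [y yU yY] : exists2 y, y \in U & y \notin Y.
  by apply/subsetPn/negP => /subset_leq_card; rewrite Ud -Yd ltnn.
rewrite sumE (aE _ x y) ?inE // -sumE big1 // => w' /andP[w'U _].
have [_ PU _] := ZP w' w'U; rewrite (_ : (y \in P w') = false) ?mulr0 //.
by apply/negP => yP; have := in_set0 y; rewrite -PU inE yP yU.
Qed.

End LinearType.

(* F is any graded free resolution of the Stanley-Reisner ring; Tor, Ext and
   the invariants built on them are computed from it.  tor_dim F (n - d) is the
   Cohen-Macaulay type. *)
Theorem proposition1p2 (K : fieldType) (n d : nat) (D : scomplex n)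
    (F : gfree_resolution (SR_ideal K D)) (reg : int)
    (hdim : sc_dim D = d%:Z - 1)
    (hCM : cohen_macaulay (SR_ring K D))
    (hcore : faces D = core D)
    (hcase : has_linear_resolution F 1 \/ is_a_invariant F (n - d)%N 0)
    (hreg : is_regularity F reg) :
  d%:Z <= reg + (tor_dim F (n - d)%N)%:Z - 1.
Proof.
have maxd : (\max_(A in faces D) #|A| = d)%N.
  by move: hdim => /addIr [].
have face_le A : A \in faces D -> (#|A| <= d)%N.
  by move=> AD; rewrite -maxd; exact: (@bigop.leq_bigmax_cond _ _ (fun B : {set 'I_n} => #|B|)).
have [A AD Ad] : exists2 A, A \in faces D & #|A| = d.
  have [|A AD] := @eq_bigmax_cond _ (mem (faces D)) (fun A => #|A|).
    by apply/card_gt0P; exists set0; apply: faces_empty.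
  by move=> AE; exists A => //; rewrite -AE.
have dn : (d <= n)%N by rewrite -Ad -[X in (_ <= X)%N]card_ord max_card.
have depth_d : local_depth_ge (@irrelevant K n D) d.
  apply/(hCM.2 _ (@irrelevant_maximal K n D)); rewrite -Ad.
  exact: irrelevant_dim.
have tor_bound p e : tor_gdim F p e <> 0%N -> e - p%:Z <= reg /\ (tor_gdim F p e <= tor_dim F p)%N.
  move=> Tpe; split; last exact: tor_gdim_le.
  by apply: (hreg.2 p); rewrite addrC subrK.
case: hcase => [Flin|[ext0 _]]; last first.
  rewrite oppr0 in ext0; have [e ne Te] := ext_neq0_tor ext0.
  by have [er Tle] := tor_bound _ _ Te; move: Te Tle er ne; lia.
have [d0|d0] := posnP d.
  (* For d = 0 there are no vertices, so the ideal is zero, against the nonzero element demanded by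
     a linear resolution. *)
  have [[f If f0] _] := Flin; case: f0; apply/mpolyP => m; rewrite mcoeff0.
  apply: (SR_coeff If); rewrite (_ : supp m = set0) ?faces_empty //.
  apply/setP => i; have := face_le _ (faces_vertex D i); rewrite cards1 d0 //.
have dT : (d <= tor_gdim F (n - d) ((n - d)%N%:Z + 1))%N.
  by apply: linear_tor_bound; rewrite ?d0.
have [|er Tle] := tor_bound (n - d)%N ((n - d)%N%:Z + 1); first by lia.
by move: dT er Tle; lia.
Qed.
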